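(* Let $p\in(0,1)$ be fixed and $\delta>0$, and let $k=k_n$, $\varepsilon=\varepsilon_n$ satisfy $k/n\le1-2p-\delta$ and $\lim_{n\to\infty}\frac{\log n}{\log(n/\varepsilon)}=0$. Then for all sufficiently large $n$ the expected Choi error of the random codes formed by $\mathfrak C_n^\varepsilon$ against the strength-$p$ i.i.d. erasure error satisfies $$\mathbb E_{U\sim\mathfrak C_n^\varepsilon}\epsilon_{\mathrm{Choi}}\le\sqrt{8\delta+\sqrt{2^{-n(1-2p-\frac kn-\delta)}+\frac{4\varepsilon^{1-\frac kn}n^{\frac kn}}{\log(n/\varepsilon)}}}.$$ That is, 1D $\omega(\log n)$-depth double-layer blocked circuits can achieve the erasure channel capacity $1-2p$: for every constant $0<R<1-2p$, with $k/n\to R$ and $\log(n/\varepsilon)=\omega(\log n)$, the expected Choi error tends to $0$ as $n\to\infty$.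
   Context: All logarithms are base 2. Double-layer blocked ensemble $\mathfrak C_n^\varepsilon$: $n$ qubits on a line are divided into $2N$ consecutive regions of $\xi=n/2N$ qubits each, with $\xi=\log(n/\varepsilon)$. $U=U_2U_1$ with $U_1=\bigotimes_{i=1}^NU_C^{2i-1,2i}$, $U_2=\bigotimes_{i=1}^{N-1}U_C^{2i,2i+1}$, where the $U_C^{j,j+1}$ are independent uniformly random Clifford unitaries on the $2\xi$ qubits of regions $j,j+1$. Such a Clifford is implementable in 1D depth $O(\xi)$, so the circuit depth is $O(\log(n/\varepsilon))$. Each region contains $\frac kn\xi$ logical qubits and $\frac{n-k}n\xi$ ancillas in $|0\rangle$. Parameters are such that all these numbers are integers. Choi error: $L$ is the $k$-qubit logical system, $S$ the $n$-qubit physical system, $R$ a $k$-qubit reference, $\hat\phi_{LR}$ the maximally entangled state, $\mathcal E(\rho)=U(\rho\otimes|0^{n-k}\rangle\langle0^{n-k}|)U^\dagger$. For a noise channel $\mathcal N$ on $S$, $\epsilon_{\mathrm{Choi}}=\min_{\mathcal D}P(\hat\phi_{LR},[(\mathcal D\circ\mathcal N\circ\mathcal E)_L\otimes I_R](\hat\phi_{LR}))$ over quantum channels $\mathcal D$ to $L$, with $P=\sqrt{1-F^2}$, $F(\rho,\sigma)=\Vert\sqrt\rho\sqrt\sigma\Vert_1$. Strength-$p$ i.i.d. erasure: $\mathcal N=\mathcal N_e^{\otimes n}$, $\mathcal N_e(\rho)=(1-p)\rho+p|2\rangle\langle2|$ with $|2\rangle$ orthogonal to the qubit space. *)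

(* Defs.v *)
From HB Require Import structures.
From mathcomp Require Import all_boot all_order all_algebra all_fingroup.
From mathcomp Require Import all_classical all_reals all_analysis.
From mathcomp Require Import spectral complex.

Set Implicit Arguments.
Unset Strict Implicit.
Unset Printing Implicit Defensive.

Import Order.TTheory GRing.Theory Num.Theory.
Import numFieldNormedType.Exports.
Local Open Scope ring_scope.
Local Open Scope sesquilinear_scope.
Local Open Scope complex_scope.

(* Operators on the Hilbert space with orthonormal basis B, a finite type.
   A system of qubits labelled by Q has basis {ffun Q -> bool}; a composite
   system has the product of the bases. *)
Definition opr (R : realType) (B : finType) := 'M[R[i]]_#|B|.

Definition mkop (R : realType) (B : finType) (f : B -> B -> R[i]) : opr R B :=
  \matrix_(i, j) f (enum_val i) (enum_val j).

Definition entry (R : realType) (B : finType) (A : opr R B) (x y : B) : R[i] :=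
  A (enum_rank x) (enum_rank y).

Definition psd (R : realType) n (A : 'M[R[i]]_n) : Prop :=
  forall v : 'rV[R[i]]_n, 0 <= (v *m A *m v^t*) 0 0.

(* Square root of a positive semidefinite matrix, by applying the square root
   to the eigenvalues in a spectral decomposition. *)
Definition sqrtmx (R : realType) n (A : 'M[R[i]]_n) : 'M[R[i]]_n :=
  invmx (spectralmx A) *m diag_mx (map_mx sqrtC (spectral_diag A))
    *m spectralmx A.

Definition trace_norm (R : realType) n (A : 'M[R[i]]_n) : R :=
  complex.Re (\tr (sqrtmx (A^t* *m A))).

Definition fidelity (R : realType) n (rho sigma : 'M[R[i]]_n) : R :=
  trace_norm (sqrtmx rho *m sqrtmx sigma).

Definition purified_distance (R : realType) n (rho sigma : 'M[R[i]]_n) : R :=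
  Num.sqrt (1 - fidelity rho sigma ^+ 2).

(* Phi (x) I_E for a linear map Phi: it acts blockwise, on the block
   <r| . |s> of the operator for each pair r, s of basis vectors of E. *)
Definition ampliation (R : realType) (A B E : finType) (Phi : opr R A -> opr R B)
    (rho : opr R (A * E)%type) : opr R (B * E)%type :=
  mkop (fun u v : B * E =>
    entry (Phi (mkop (fun a b : A => entry rho (a, u.2) (b, v.2)))) u.1 v.1).

Definition quantum_channel (R : realType) (A B : finType)
    (Phi : opr R A -> opr R B) : Prop :=
  [/\ linear Phi,
      forall d (rho : opr R (A * 'I_d)%type), psd rho -> psd (ampliation Phi rho)
    & forall rho, \tr (Phi rho) = \tr rho].

(* Phi^{(x) Q}, by linear extension from the matrix units
   |x><y| = (x)_q |x_q><y_q|. *)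
Definition tensor_power (R : realType) (A B Q : finType)
    (Phi : opr R A -> opr R B) (rho : opr R {ffun Q -> A}) :
    opr R {ffun Q -> B} :=
  mkop (fun u v : {ffun Q -> B} => \sum_(x : {ffun Q -> A}) \sum_(y : {ffun Q -> A})
    entry rho x y *
    \prod_(q : Q)
      entry (Phi (mkop (fun a b : A => ((a == x q) && (b == y q))%:R))) (u q) (v q)).

Definition max_entangled (R : realType) (L : finType) : opr R (L * L)%type :=
  mkop (fun u v : L * L => ((u.1 == u.2) && (v.1 == v.2))%:R / #|L|%:R).

(* The minimum over decoders is written as an infimum; the set is nonempty and
   bounded below by 0. *)
Definition choi_error (R : realType) (L S O : finType)
    (enc : opr R L -> opr R S) (noise : opr R S -> opr R O) : R :=
  inf [set e | exists dec : opr R O -> opr R L, quantum_channel dec /\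
    e = purified_distance (max_entangled R L)
          (ampliation (dec \o noise \o enc) (max_entangled R L))]%classic.

(* The orthogonal flag state |2> is the basis vector None. *)
Definition erasure (R : realType) (p : R) (rho : opr R bool) :
    opr R (option bool) :=
  mkop (fun u v : option bool => match u, v with
    | Some x, Some y => (1 - p)%:C * entry rho x y
    | None, None => p%:C * \tr rho
    | _, _ => 0
    end).

(* Pauli group on the qubits Q: (c, a) labels i^c (x)_q X^{(a q).1} Z^{(a q).2}.
   Distinct labels denote distinct matrices. *)
Definition pauli (Q : finType) : finType :=
  ('I_4 * {ffun Q -> bool * bool})%type.

Definition pauli_mx (R : realType) (Q : finType) (P : pauli Q) :
    opr R {ffun Q -> bool} :=
  mkop (fun x y : {ffun Q -> bool} => 'i ^+ P.1 *
    \prod_(q : Q) ((x q == y q (+) (P.2 q).1)%:R *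
                   (-1) ^+ ((P.2 q).2 && y q : bool))).

Definition clifford (R : realType) (Q : finType) (U : opr R {ffun Q -> bool}) :
    Prop :=
  U \is unitarymx /\
  forall P : pauli Q, exists P', U *m pauli_mx R P *m U^t* = pauli_mx R P'.

Definition clifford_acts (R : realType) (Q : finType)
    (U : opr R {ffun Q -> bool}) (s : {perm pauli Q}) : Prop :=
  clifford U /\ forall P, U *m pauli_mx R P *m U^t* = pauli_mx R (s P).

(* The Clifford group modulo global phases. A Clifford unitary is determined up
   to its phase by the permutation of the Pauli group that it induces, so this
   is the finite set of the permutations induced by Clifford unitaries.
   A uniformly random Clifford unitary is a uniform element of this set,
   realized by some unitary inducing it; the encoder U rho U^t* does not depend
   on the phase. *)
Definition clifford_classes (R : realType) (Q : finType) : {set {perm pauli Q}} :=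
  finset (fun s => `[< exists U : opr R {ffun Q -> bool}, clifford_acts U s >]).

Definition clifford_repr (R : realType) (Q : finType) (s : {perm pauli Q}) :
    opr R {ffun Q -> bool} :=
  xget 1%:M [set U | clifford_acts U s]%classic.

(* G on the qubits e(Q), tensored with the identity on the other qubits of Q';
   e is meant to be injective. *)
Definition gate_on (R : realType) (Q Q' : finType) (e : Q -> Q')
    (G : opr R {ffun Q -> bool}) : opr R {ffun Q' -> bool} :=
  mkop (fun x y : {ffun Q' -> bool} =>
    if [forall q', (q' \notin codom e) ==> (x q' == y q')]
    then entry G [ffun q => x (e q)] [ffun q => y (e q)] else 0).

(* A region has kappa logical qubits (inl) and alpha ancillas (inr); the order
   of the qubits within a region plays no role for the ensemble. *)
Definition region (kappa alpha : nat) : finType := ('I_kappa + 'I_alpha)%type.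

Definition logical (N kappa : nat) : finType :=
  {ffun 'I_N.*2 * 'I_kappa -> bool}.

Definition physical (N kappa alpha : nat) : finType :=
  {ffun 'I_N.*2 * region kappa alpha -> bool}.

Definition received (N kappa alpha : nat) : finType :=
  {ffun 'I_N.*2 * region kappa alpha -> option bool}.

Lemma adjacent_region_proof M (j : 'I_M.-1) (b : bool) : (j + b < M)%N.
Proof. by case: M j => [|M] [j ltj] //=; case: b; rewrite ?addn0 ?addn1 // ltnW. Qed.

(* The two regions j, j.+1 (counted from 0) on which the j-th gate acts. *)
Definition adjacent_region M (j : 'I_M.-1) (b : bool) : 'I_M :=
  Ordinal (adjacent_region_proof j b).

Definition adjacent_qubits N kappa alpha (j : 'I_N.*2.-1)
    (q : bool * region kappa alpha) : 'I_N.*2 * region kappa alpha :=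
  (adjacent_region j q.1, q.2).

Definition gate_choice (N kappa alpha : nat) : finType :=
  {ffun 'I_N.*2.-1 -> {perm pauli (bool * region kappa alpha)%type}}.

(* With regions counted from 0, the first layer consists of the gates on
   regions j, j.+1 with j even, the second one of those with j odd. *)
Definition layer (R : realType) N kappa alpha (G : gate_choice N kappa alpha)
    (b : bool) : opr R (physical N kappa alpha) :=
  \big[mulmx/1%:M]_(j < N.*2.-1 | odd j == b)
    gate_on (adjacent_qubits j) (clifford_repr R (G j)).

Definition circuit (R : realType) N kappa alpha (G : gate_choice N kappa alpha) :
    opr R (physical N kappa alpha) :=
  layer R G true *m layer R G false.

Definition add_ancillas (R : realType) N kappa alpha
    (rho : opr R (logical N kappa)) : opr R (physical N kappa alpha) :=
  let anc0 (x : physical N kappa alpha) := [forall r, forall a, ~~ x (r, inr a)] in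
  let log (x : physical N kappa alpha) : logical N kappa :=
    [ffun q => x (q.1, inl q.2)] in
  mkop (fun x y : physical N kappa alpha =>
    if anc0 x && anc0 y then entry rho (log x) (log y) else 0).

Definition encoder (R : realType) N kappa alpha (U : opr R (physical N kappa alpha))
    (rho : opr R (logical N kappa)) : opr R (physical N kappa alpha) :=
  U *m add_ancillas alpha rho *m U^t*.

(* Uniform on families of Clifford classes, i.e. independent uniform gates *)
Definition ensemble (R : realType) N kappa alpha : {set gate_choice N kappa alpha} :=
  finset (fun G : gate_choice N kappa alpha => [forall j, G j \in clifford_classes R _]).

Definition expected_choi_error_blocks (R : realType) (N kappa alpha : nat) (p : R) : R :=
  (\sum_(G : gate_choice N kappa alpha | G \in ensemble R N kappa alpha)
     choi_error (encoder (circuit R G)) (tensor_power (erasure p)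
       : opr R (physical N kappa alpha) -> opr R (received N kappa alpha)))
  / #|ensemble R N kappa alpha|%:R.

Definition log2 (R : realType) (x : R) : R := ln x / ln 2.

Definition region_size (R : realType) (n : nat) (eps : R) : nat :=
  Num.truncn (log2 (n%:R / eps)).

(* All the numbers xi = log2 (n / eps), N = n / (2 xi), k xi / n and
   (n - k) xi / n are integers; together with 0 < n they force xi, N > 0. *)
Definition admissible (R : realType) (n k : nat) (eps : R) : Prop :=
  let xi := region_size n eps in
  [/\ (0 < n)%N /\ (k <= n)%N,
      0 < eps /\ xi%:R = log2 (n%:R / eps),
      (2 * xi %| n)%N
    & (n %| k * xi)%N /\ (n %| (n - k) * xi)%N].

(* Meaningful when n, k, eps are admissible, in which case the divisions
   are exact. *)
Definition expected_choi_error (R : realType) (n k : nat) (eps p : R) : R :=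
  let xi := region_size n eps in
  expected_choi_error_blocks (n %/ (2 * xi)) (k * xi %/ n) ((n - k) * xi %/ n) p.

(* Main.v *)
From HB Require Import structures.
Require Import Defs.
From mathcomp Require Import all_boot all_order all_algebra all_fingroup.
From mathcomp Require Import all_classical all_reals all_analysis.
From mathcomp Require Import spectral complex ring lra zify.

Set Implicit Arguments.
Unset Strict Implicit.
Unset Printing Implicit Defensive.

Import Order.TTheory GRing.Theory Num.Theory.
Import numFieldNormedType.Exports.
Local Open Scope ring_scope.

(* Since the right-hand side is at least [sqrt (8 delta)], both parts follow once the expected
   error tends to 0 when k/n stays below 1 - 2p - delta and xi / log n tends to infinity.

   The receiver sees which qubits are erased. If every nontrivial Pauli supported on the
   erased qubits is mapped by [U^* . U] to a Pauli with an X factor on some ancilla, then the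
   erased qubits are maximally mixed whatever the encoded state, and the state is recovered
   exactly; so the Choi error is at most the square root of the probability of the other
   patterns. A random Clifford class maps a nonzero Pauli label to a uniform nonzero label.
   Hence, if [alpha] is the number of ancillas per region, the two layers leave a given label
   without X factor on the ancillas with probability at most the product of 3 2^-alpha over
   the regions on which it is nonzero. Summed over the labels supported on the erased qubits,
   these bounds factor over the regions, and a Chernoff bound makes the contribution of each
   region exponentially small in xi, which beats the number of regions. *)

(** * Operators and fidelity *)

(** Write [xi] for [kappa + alpha]. A region with [e] erased qubits carries [4^e] labels supported
    on them, and the mean [(1 + 3p)^xi] of this number is dominated by atypical patterns: a plain
    union bound would ask for [alpha / xi] above [log2 (1 + 3p)], which exceeds [2p]. Therefore the
    failure probability of each pattern is capped at 1, and the cap is passed on to the single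
    regions, before the patterns are averaged. The inequality [min(1, 3x) <= 3 x^tau] with a small
    fixed [tau] then gives an exponent whose first-order part in [tau] is proportional to
    [2p xi - alpha]; this is the origin of the threshold [1 - 2p]. Recovery rests on Knill-Laflamme
    orthogonality of the Kraus operators, which makes the decoder explicit. The square root in the
    Choi error is replaced by a tangent line, so that the average over circuits passes inside. *)

Section Operators.
Local Open Scope sesquilinear_scope.
Local Open Scope complex_scope.
Variable R : realType.
Local Notation C := R[i].
Implicit Types A B D : finType.

(** Rectangular version of [mkop], because isometries and Kraus operators go between different
    systems. On square operators [ent] is convertible to [entry]. *)
Definition rop A B (f : A -> B -> C) : 'M[C]_(#|A|, #|B|) :=
  \matrix_(i, j) f (enum_val i) (enum_val j).

Definition ent A B (M : 'M[C]_(#|A|, #|B|)) (x : A) (y : B) : C :=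
  M (enum_rank x) (enum_rank y).

Lemma ent_rop A B (f : A -> B -> C) x y : ent (rop f) x y = f x y.
Proof. by rewrite /ent mxE !enum_rankK. Qed.

Lemma ent_inj A B (M N : 'M[C]_(#|A|, #|B|)) : ent M =2 ent N -> M = N.
Proof.
move=> h; apply/matrixP=> i j; have := h (enum_val i) (enum_val j).
by rewrite /ent !enum_valK.
Qed.

Lemma sum_enum A (F : A -> C) : \sum_(i < #|A|) F (enum_val i) = \sum_x F x.
Proof.
rewrite [RHS](reindex_onto enum_val enum_rank) => [|x _]; last by rewrite enum_rankK.
by apply: eq_bigl => i; rewrite enum_valK eqxx.
Qed.

Lemma ent_mul A B D (M : 'M[C]_(#|A|, #|B|)) (N : 'M[C]_(#|B|, #|D|)) x z :
  ent (M *m N) x z = \sum_y ent M x y * ent N y z.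
Proof.
rewrite /ent mxE -[RHS]sum_enum; apply: eq_bigr => j _.
by rewrite enum_valK.
Qed.

Lemma ent_adj A B (M : 'M[C]_(#|A|, #|B|)) x y : ent (M ^t*) x y = Num.conj (ent M y x).
Proof. by rewrite /ent !mxE. Qed.

Lemma ent_sum I (r : seq I) (P : pred I) A B (F : I -> 'M[C]_(#|A|, #|B|)) x y :
  ent (\sum_(i <- r | P i) F i) x y = \sum_(i <- r | P i) ent (F i) x y.
Proof. by rewrite /ent summxE. Qed.

Lemma ent_scale A B c (M : 'M[C]_(#|A|, #|B|)) x y : ent (c *: M) x y = c * ent M x y.
Proof. by rewrite /ent mxE. Qed.


Lemma ent_scalar A (c : C) (x y : A) : ent c%:M x y = c *+ (x == y).
Proof. by rewrite /ent mxE (inj_eq enum_rank_inj). Qed.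

Lemma tr_ent A (M : 'M[C]_#|A|) : \tr M = \sum_x ent M x x.
Proof. by rewrite /mxtrace -[RHS]sum_enum; apply: eq_bigr => i _; rewrite /ent enum_valK. Qed.

Lemma adjD m n (M N : 'M[C]_(m, n)) : (M + N) ^t* = M ^t* + N ^t*.
Proof. by apply/matrixP=> i j; rewrite !mxE rmorphD. Qed.

Lemma adjM m n q (M : 'M[C]_(m, n)) (N : 'M[C]_(n, q)) : (M *m N) ^t* = N ^t* *m M ^t*.
Proof. by rewrite trmx_mul map_mxM. Qed.

Lemma adjZ m n c (M : 'M[C]_(m, n)) : (c *: M) ^t* = Num.conj c *: M ^t*.
Proof. by apply/matrixP=> i j; rewrite !mxE rmorphM. Qed.

Lemma adj_sum I (r : seq I) (P : pred I) m n (F : I -> 'M[C]_(m, n)) :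
  (\sum_(i <- r | P i) F i) ^t* = \sum_(i <- r | P i) (F i) ^t*.
Proof.
apply/matrixP=> i j; rewrite !mxE summxE rmorph_sum summxE.
by apply: eq_bigr => k _; rewrite !mxE.
Qed.

Lemma adj_scalar n (c : C) : (c%:M : 'M[C]_n) ^t* = (Num.conj c)%:M.
Proof. by rewrite tr_scalar_mx map_scalar_mx. Qed.

Lemma adj1 n : (1%:M : 'M[C]_n) ^t* = 1%:M.
Proof. by rewrite adj_scalar rmorph1. Qed.

Lemma quad_adj n m (N : 'M[C]_(n, m)) (v : 'rV[C]_n) :
  0 <= (v *m (N *m N ^t*) *m v ^t*) 0 0.
Proof.
rewrite mulmxA -mulmxA -adjM mxE sumr_ge0 // => i _.
by rewrite !mxE mul_conjC_ge0.
Qed.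

Definition hpsd n (M : 'M[C]_n) := M ^t* = M /\ psd M.

Lemma hpsd_adj n m (N : 'M[C]_(n, m)) : hpsd (N *m N ^t*).
Proof. by split; [rewrite adjM trmxCK | move=> v; exact: quad_adj]. Qed.

Lemma hpsd_normal n (M : 'M[C]_n) : hpsd M -> M \is normalmx.
Proof. by move=> [h _]; apply/normalmxP; rewrite h. Qed.

Lemma normal_spectral n (M : 'M[C]_n) : M \is normalmx ->
  M = (spectralmx M) ^t* *m diag_mx (spectral_diag M) *m spectralmx M.
Proof.
by move=> /orthomx_spectralP {1}->; rewrite invmx_unitary ?spectral_unitarymx.
Qed.

Lemma spectralV n (M : 'M[C]_n) : spectralmx M *m (spectralmx M) ^t* = 1%:M.
Proof. exact/unitarymxP/spectral_unitarymx. Qed.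

Lemma spectralK n (M : 'M[C]_n) : (spectralmx M) ^t* *m spectralmx M = 1%:M.
Proof.
by have /mulmx1C := spectralV M.
Qed.

Lemma sqrtmxE n (M : 'M[C]_n) : sqrtmx M =
  (spectralmx M) ^t* *m diag_mx (map_mx sqrtC (spectral_diag M)) *m spectralmx M.
Proof. by rewrite /sqrtmx invmx_unitary ?spectral_unitarymx. Qed.

Lemma spectral_diag_mulmx n (M : 'M[C]_n) : M \is normalmx ->
  diag_mx (spectral_diag M) = spectralmx M *m M *m (spectralmx M) ^t*.
Proof.
move=> /normal_spectral; have := spectralV M.
move: (spectralmx M) (spectral_diag M) => P d PV ->.
by rewrite !mulmxA PV mul1mx -mulmxA PV mulmx1.
Qed.

Lemma spectral_diag_ge0 n (M : 'M[C]_n) i : hpsd M -> 0 <= spectral_diag M 0 i.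
Proof.
move=> hM; have /spectral_diag_mulmx/matrixP/(_ i i) := hpsd_normal hM.
rewrite mxE eqxx mulr1n => ->; have [_ /(_ (row i (spectralmx M)))] := hM.
rewrite -row_mul mxE [in X in _ -> X]mxE.
by under eq_bigr do rewrite !mxE; under [in X in _ -> X]eq_bigr do rewrite !mxE.
Qed.

Lemma sqrtmxK n (M : 'M[C]_n) : M \is normalmx -> sqrtmx M *m sqrtmx M = M.
Proof.
move=> hM; rewrite [RHS]normal_spectral // sqrtmxE; have := spectralV M.
move: (spectralmx M) (spectral_diag M) => P d PV.
have <- : diag_mx (map_mx sqrtC d) *m diag_mx (map_mx sqrtC d) = diag_mx d.
  rewrite mulmx_diag; apply/f_equal/rowP => j.
  by rewrite [LHS]mxE [in LHS]mxE -expr2 sqrtCK.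
move: (diag_mx (map_mx sqrtC d)) => D.
by rewrite -!mulmxA [P *m (P ^t* *m _)]mulmxA PV mul1mx.
Qed.

Lemma sqrtmx_adj n (M : 'M[C]_n) : hpsd M -> (sqrtmx M) ^t* = sqrtmx M.
Proof.
move=> hM; rewrite sqrtmxE.
have := fun i => spectral_diag_ge0 i hM.
move: (spectralmx M) (spectral_diag M) => P d d0.
have e : (diag_mx (map_mx sqrtC d)) ^t* = diag_mx (map_mx sqrtC d).
  rewrite tr_diag_mx map_diag_mx; apply/f_equal/rowP => j.
  rewrite [LHS]mxE [in LHS]mxE [RHS]mxE; apply: geC0_conj.
  by rewrite sqrtC_ge0 d0.
by rewrite !adjM trmxCK e mulmxA.
Qed.

(** Idempotence becomes [d * (d - 1) = 0] for every eigenvalue, and the square root fixes 0 and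
    1. *)
Lemma sqrtmx_proj n (M : 'M[C]_n) : M ^t* = M -> M *m M = M -> sqrtmx M = M.
Proof.
move=> hM MM; have nM : M \is normalmx by apply/normalmxP; rewrite hM.
suff e : map_mx sqrtC (spectral_diag M) = spectral_diag M.
  by rewrite sqrtmxE e -normal_spectral.
have : diag_mx (spectral_diag M) *m diag_mx (spectral_diag M) = diag_mx (spectral_diag M).
  rewrite spectral_diag_mulmx //; have := spectralK M.
  move: (spectralmx M) => P PV.
  by rewrite -!mulmxA [P ^t* *m (P *m _)]mulmxA PV mul1mx [M *m (M *m _)]mulmxA MM.
move: (spectral_diag M) => d; rewrite mulmx_diag => /matrixP h.
apply/rowP => j; rewrite [LHS]mxE.
have := h j j; rewrite !mxE eqxx !mulr1n => h1.
have : d 0 j * (d 0 j - 1) = 0 by rewrite mulrBr mulr1 h1 subrr.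
by move/eqP; rewrite mulf_eq0 subr_eq0 => /orP[]/eqP ->; rewrite ?sqrtC0 ?sqrtC1.
Qed.

Lemma Re_le (x y : C) : x <= y -> complex.Re x <= complex.Re y.
Proof. by rewrite lecE => /andP[]. Qed.

Lemma sqr_sum_ge (I : finType) (F : I -> C) : (forall i, 0 <= F i) ->
  \sum_i F i ^+ 2 <= (\sum_i F i) ^+ 2.
Proof.
move=> h; rewrite expr2 mulr_suml; apply: ler_sum => i _.
by rewrite expr2 ler_wpM2l // (bigD1 i) //= lerDl sumr_ge0.
Qed.

(** In terms of singular values this is [sum s_i^2 <= (sum s_i)^2]: the Hilbert-Schmidt norm is at
    most the trace norm. *)
Lemma trace_norm_ge n (M : 'M[C]_n) :
  complex.Re (\tr (M ^t* *m M)) <= trace_norm M ^+ 2.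
Proof.
rewrite /trace_norm.
have : hpsd (M ^t* *m M) by rewrite -{2}[M]trmxCK; exact: hpsd_adj.
move: (M ^t* *m M) => A hA.
have trA : \tr A = \sum_i spectral_diag A 0 i.
  rewrite {1}(normal_spectral (hpsd_normal hA)) -mulmxA mxtrace_mulC -mulmxA spectralV mulmx1.
  by rewrite mxtrace_diag.
have trS : \tr (sqrtmx A) = \sum_i sqrtC (spectral_diag A 0 i).
  rewrite sqrtmxE -mulmxA mxtrace_mulC -mulmxA spectralV mulmx1.
  by rewrite mxtrace_diag; apply: eq_bigr => i _; rewrite mxE.
have s0 i : 0 <= sqrtC (spectral_diag A 0 i) by rewrite sqrtC_ge0 spectral_diag_ge0.
have S0 : 0 <= \tr (sqrtmx A) by rewrite trS sumr_ge0.
have : \tr A <= \tr (sqrtmx A) ^+ 2.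
  rewrite trA trS; apply: le_trans (sqr_sum_ge s0).
  by apply: ler_sum => i _; rewrite sqrtCK.
move/Re_le => /le_trans; apply.
rewrite -[X in complex.Re (X ^+ 2)]RRe_real ?ger0_real //.
by rewrite -rmorphXn.
Qed.

(** Since [sqrtmx P = P], the squared Hilbert-Schmidt norm of [P *m sqrtmx S] is the trace of
    [P *m S]. A lower bound on the fidelity suffices for an upper bound on the Choi error. *)
Lemma fidelity_proj_ge n (P S : 'M[C]_n) : P ^t* = P -> P *m P = P -> hpsd S ->
  complex.Re (\tr (P *m S)) <= fidelity P S ^+ 2.
Proof.
move=> hP PP hS; rewrite /fidelity sqrtmx_proj //.
apply: le_trans (trace_norm_ge _); rewrite adjM sqrtmx_adj // hP.
have : sqrtmx S *m sqrtmx S = S by apply: sqrtmxK; exact: hpsd_normal.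
move: (sqrtmx S) => Q QQ.
by rewrite -mulmxA [P *m (P *m _)]mulmxA PP [\tr (Q *m _)]mxtrace_mulC -mulmxA QQ.
Qed.

End Operators.

(** * Maps in Kraus form *)

Section Kraus.
Local Open Scope sesquilinear_scope.
Local Open Scope complex_scope.
Variable R : realType.
Local Notation C := R[i].
Implicit Types A B D E K L O T : finType.

(** The weights stay outside the operators, so that neither the erasure probabilities nor the
    normalization of the decoder introduces square roots. *)
Definition kraus (K A B : finType) (w : K -> C) (M : K -> 'M[C]_(#|B|, #|A|))
    (rho : 'M[C]_#|A|) : 'M[C]_#|B| :=
  \sum_k w k *: (M k *m rho *m (M k) ^t*).

Lemma kraus_linear (K A B : finType) (w : K -> C) (M : K -> 'M[C]_(#|B|, #|A|)) :
  linear (kraus w M).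
Proof.
move=> a x y; rewrite /kraus scaler_sumr -big_split /=; apply: eq_bigr => k _.
by rewrite mulmxDr mulmxDl -scalemxAr -scalemxAl scalerDr !scalerA mulrC.
Qed.

Lemma kraus_trace (K A B : finType) (w : K -> C) (M : K -> 'M[C]_(#|B|, #|A|)) rho :
  \sum_k w k *: ((M k) ^t* *m M k) = 1%:M -> \tr (kraus w M rho) = \tr rho.
Proof.
move=> h; rewrite -[in RHS](mul1mx rho) -h mulmx_suml !raddf_sum; apply: eq_bigr => k _ /=.
by rewrite -scalemxAl !mxtraceZ mxtrace_mulC mulmxA.
Qed.

Lemma kraus_comp (K T A B D : finType) (w : K -> C) (M : K -> 'M[C]_(#|D|, #|B|))
    (w' : T -> C) (M' : T -> 'M[C]_(#|B|, #|A|)) rho :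
  kraus w M (kraus w' M' rho) =
  kraus (fun kt : K * T => w kt.1 * w' kt.2) (fun kt => M kt.1 *m M' kt.2) rho.
Proof.
rewrite /kraus -(pair_bigA _ (fun k t => (w k * w' t) *: (M k *m M' t *m rho *m (M k *m M' t) ^t*))).
apply: eq_bigr => k _ /=.
rewrite mulmx_sumr mulmx_suml scaler_sumr; apply: eq_bigr => t _.
by rewrite -scalemxAr -scalemxAl scalerA adjM !mulmxA.
Qed.

Definition lift_op A B E (M : 'M[C]_(#|B|, #|A|)) : 'M[C]_(#|{: B * E}|, #|{: A * E}|) :=
  rop (fun (u : B * E) (v : A * E) => ent M u.1 v.1 *+ (u.2 == v.2)).

Lemma sum_pair_eq A E (F : A * E -> C) e : \sum_x F x *+ (e == x.2) = \sum_a F (a, e).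
Proof.
rewrite (eq_bigr (fun x => F (x.1, x.2) *+ (e == x.2))) => [|[]//].
rewrite -(pair_bigA _ (fun a f => F (a, f) *+ (e == f))) /=.
apply: eq_bigr => a _; rewrite (bigD1 e) //= eqxx big1 ?addr0 // => f.
by rewrite eq_sym => /negPf ->.
Qed.

Lemma ampliation_kraus K A B E (w : K -> C) (M : K -> 'M[C]_(#|B|, #|A|))
    (rho : opr R (A * E)%type) :
  ampliation (kraus w M) rho = kraus w (fun k => lift_op E (M k)) rho.
Proof.
apply: ent_inj => u v; rewrite /ampliation [LHS]ent_rop /entry -/(ent _ _ _) !ent_sum.
apply: eq_bigr => k _; rewrite !ent_scale; congr (_ * _).
rewrite !ent_mul.
under [RHS]eq_bigr => y _ do rewrite ent_adj ent_rop rmorphMn /= mulrnAr.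
rewrite sum_pair_eq; apply: eq_bigr => b _; rewrite ent_adj; congr (_ * _).
rewrite !ent_mul.
under [RHS]eq_bigr => y _ do rewrite ent_rop mulrnAl.
rewrite sum_pair_eq; apply: eq_bigr => a _; congr (_ * _).
by rewrite ent_rop.
Qed.

Lemma kraus_psd K A B (w : K -> C) (M : K -> 'M[C]_(#|B|, #|A|)) rho :
  (forall k, 0 <= w k) -> psd rho -> psd (kraus w M rho).
Proof.
move=> w0 h v; rewrite mulmx_sumr mulmx_suml summxE sumr_ge0 // => k _.
rewrite -scalemxAr -scalemxAl mxE mulr_ge0 //.
have := h (v *m M k); congr (_ <= _); rewrite adjM !mulmxA.
by [].
Qed.

Lemma kraus_herm K A B (w : K -> C) (M : K -> 'M[C]_(#|B|, #|A|)) rho :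
  (forall k, 0 <= w k) -> rho ^t* = rho -> (kraus w M rho) ^t* = kraus w M rho.
Proof.
move=> w0 h; rewrite adj_sum; apply: eq_bigr => k _.
rewrite adjZ (geC0_conj (w0 k)); congr (_ *: _).
by move: (M k) => N; rewrite !adjM trmxCK h mulmxA.
Qed.

Lemma kraus_channel K A B (w : K -> C) (M : K -> 'M[C]_(#|B|, #|A|)) :
  (forall k, 0 <= w k) -> \sum_k w k *: ((M k) ^t* *m M k) = 1%:M ->
  quantum_channel (kraus w M : opr R A -> opr R B).
Proof.
move=> w0 h; split; first exact: kraus_linear.
  by move=> d rho hr; rewrite ampliation_kraus; exact: kraus_psd.
by move=> rho; exact: kraus_trace.
Qed.

Lemma max_entangled_herm L : (max_entangled R L) ^t* = max_entangled R L.
Proof.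
apply: ent_inj => u v; rewrite ent_adj !ent_rop rmorphM fmorphV !rmorph_nat.
by rewrite andbC.
Qed.

Lemma sum_diag L (F : L * L -> C) : \sum_u F u *+ (u.1 == u.2) = \sum_a F (a, a).
Proof.
rewrite (eq_bigr (fun u => F (u.1, u.2) *+ (u.1 == u.2))) => [|[]//].
rewrite -(pair_bigA _ (fun a b => F (a, b) *+ (a == b))) /=.
apply: eq_bigr => a _; rewrite (bigD1 a) //= eqxx big1 ?addr0 // => f.
by rewrite eq_sym => /negPf ->.
Qed.

Lemma max_entangled_idem L : (0 < #|L|)%N ->
  max_entangled R L *m max_entangled R L = max_entangled R L.
Proof.
move=> L0; apply: ent_inj => u v; rewrite ent_mul !ent_rop.
rewrite (eq_bigr (fun z : L * L => (((u.1 == u.2) && (v.1 == v.2))%:R / #|L|%:R / #|L|%:R)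
    *+ (z.1 == z.2))) => [|z _]; last first.
  rewrite !ent_rop; case: (u.1 == u.2); case: (v.1 == v.2); case: (z.1 == z.2);
    by rewrite /= ?mul0r ?mulr0 ?mul0rn ?mulr1n ?mulr0n ?mul1r.
rewrite (sum_diag (fun _ => _)) sumr_const -[X in X = _]mulr_natr divfK //.
by rewrite pnatr_eq0 -lt0n.
Qed.

Lemma max_entangled_psd L : (0 < #|L|)%N -> psd (max_entangled R L).
Proof.
move=> L0 v; rewrite -(max_entangled_idem L0) -{2}max_entangled_herm.
exact: quad_adj.
Qed.

Lemma ampliation_max_entangled K L (w : K -> C) (M : K -> 'M[C]_#|L|) (a b : L) :
  ent (ampliation (kraus w M : opr R L -> opr R L) (max_entangled R L)) (b, b) (a, a) =
  \sum_k w k * (ent (M k) b b * Num.conj (ent (M k) a a)) / #|L|%:R.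
Proof.
rewrite ent_rop /entry -/(ent _ _ _) ent_sum; apply: eq_bigr => k _.
rewrite ent_scale -mulrA; congr (_ * _); rewrite ent_mul.
rewrite (bigD1 a) //= [X in _ + X]big1 => [|c ca]; last first.
  rewrite ent_mul big1 ?mul0r // => x _; rewrite ent_rop /entry -/(ent _ _ _) ent_rop.
  by rewrite /= (negPf ca) andbF mul0r mulr0.
rewrite addr0 ent_mul (bigD1 b) //= [X in _ + X]big1 => [|c cb]; last first.
  rewrite ent_rop /entry -/(ent _ _ _) ent_rop.
  by rewrite /= (negPf cb) mul0r mulr0.
rewrite addr0 ent_rop /entry -/(ent _ _ _) ent_rop /= !eqxx ent_adj mul1r.
by rewrite mulrAC.
Qed.

(** The maximally entangled vector has amplitude [\tr (M k) / #|L|] under [M k] tensored with the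
    identity, so the left side is the overlap of the output with the maximally entangled
    projection. *)
Lemma fidelity_kraus K L (w : K -> C) (M : K -> 'M[C]_#|L|) :
  (0 < #|L|)%N -> (forall k, 0 <= w k) ->
  complex.Re (\sum_k w k * (`|\tr (M k)| / #|L|%:R) ^+ 2) <=
  fidelity (max_entangled R L)
    (ampliation (kraus w M : opr R L -> opr R L) (max_entangled R L)) ^+ 2.
Proof.
move=> L0 w0; have hP := max_entangled_herm L.
have := @fidelity_proj_ge _ _ (max_entangled R L)
  (ampliation (kraus w M : opr R L -> opr R L) (max_entangled R L)) hP (max_entangled_idem L0).
have hS : hpsd (ampliation (kraus w M : opr R L -> opr R L) (max_entangled R L)).
  rewrite ampliation_kraus; split; first exact: kraus_herm.
  by apply: kraus_psd => //; exact: max_entangled_psd.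
move=> /(_ hS); apply: le_trans; rewrite le_eqVlt; apply/orP; left; apply/eqP.
congr complex.Re; rewrite tr_ent.
pose X u v := ent (ampliation (kraus w M : opr R L -> opr R L) (max_entangled R L)) u v / #|L|%:R.
rewrite (eq_bigr (fun u : L * L => (\sum_a X (a, a) u) *+ (u.1 == u.2))) => [|u _]; last first.
  rewrite ent_mul (eq_bigr (fun v : L * L => X v u *+ (u.1 == u.2) *+ (v.1 == v.2))) => [|v _].
    by rewrite (sum_diag (fun v => _)) sumrMnl.
  rewrite ent_rop /X; case: (u.1 == u.2); case: (v.1 == v.2);
    by rewrite /= ?mul0r ?mulr0 ?mul0rn ?mulr1n ?mulr0n ?mul1r // mulrC.
rewrite (sum_diag (fun u => _)).
under [RHS]eq_bigr do under eq_bigr do rewrite /X ampliation_max_entangled.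
transitivity (\sum_k \sum_a \sum_b w k * (ent (M k) b b * Num.conj (ent (M k) a a)) / #|L|%:R / #|L|%:R).
  apply: eq_bigr => k _.
  rewrite expr_div_n normCK tr_ent rmorph_sum mulr_suml.
  rewrite mulrA mulr_sumr mulr_suml exchange_big /=.
  by apply: eq_bigr => b _; rewrite !mulr_sumr !mulr_suml; apply: eq_bigr => a _;
    rewrite expr2 invfM !mulrA.
rewrite exchange_big /=; apply: eq_bigr => a _; rewrite exchange_big; apply: eq_bigr => b _.
by rewrite mulr_suml.
Qed.

End Kraus.

(** * Recovery *)

Section Recovery.
Local Open Scope sesquilinear_scope.
Local Open Scope complex_scope.
Variable R : realType.
Local Notation C := R[i].

Lemma choi_error_ge0 (L S O : finType) (enc : opr R L -> opr R S)
    (noise : opr R S -> opr R O) : 0 <= choi_error enc noise.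
Proof.
rewrite /choi_error; case: (pselect (has_inf [set e | exists dec : opr R O -> opr R L,
  quantum_channel dec /\ e = purified_distance (max_entangled R L)
          (ampliation (dec \o noise \o enc) (max_entangled R L))]%classic)) => [[h _]|h].
  by apply: lb_le_inf => // x [dec [_ ->]]; exact: sqrtr_ge0.
(* By convention [inf] is 0 on a set that has no infimum. *)
by rewrite inf_out.
Qed.

Lemma choi_error_le_dec (L S O : finType) (enc : opr R L -> opr R S)
    (noise : opr R S -> opr R O) (dec : opr R O -> opr R L) :
  quantum_channel dec ->
  choi_error enc noise <= purified_distance (max_entangled R L)
          (ampliation (dec \o noise \o enc) (max_entangled R L)).
Proof.
move=> h; apply: ge_inf; last by exists dec.
by exists 0 => x [d [_ ->]]; exact: sqrtr_ge0.
Qed.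

(* The decoder has Kraus operators [M_t^* / sqrt nu_t] for good [t], completed to a
   trace-preserving map by the operators [|l0><u| (1 - Pi)], where [Pi] projects onto
   the joint range of the good [M_t]. *)
Lemma choi_error_recovery (L S O T : finType) (enc : opr R L -> opr R S)
    (noise : opr R S -> opr R O) (w nu : T -> R) (M : T -> 'M[C]_(#|O|, #|L|))
    (good : pred T) :
  (0 < #|L|)%N -> (forall t, 0 <= w t) -> (forall t, 0 < nu t) ->
  (forall rho, noise (enc rho) = kraus (fun t => (w t)%:C) M rho) ->
  (forall t t', good t -> (M t) ^t* *m M t' = ((nu t)%:C *+ (t == t'))%:M) ->
  choi_error enc noise <= Num.sqrt (1 - \sum_(t | good t) w t * nu t).
Proof.
move=> L0 w0 nu0 hN hM.
have nuC0 t : (nu t)%:C != 0 by rewrite eq_complex /= eqxx andbT gt_eqF.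
have [l0 _] : exists l0 : L, l0 \in predT by apply/card_gt0P.
(* Bad indices get weight 0, which lets all sums range over the whole of [T]. *)
pose c t : C := if good t then (nu t)%:C^-1 else 0.
have c0 t : 0 <= c t.
  by rewrite /c; case: ifP => // _; rewrite invr_ge0 ler0c ltW.
have MM t t' : c t *: ((M t) ^t* *m M t') = ((good t) && (t == t'))%:R%:M.
  rewrite /c; case: ifPn => [gt|_]; last by rewrite scale0r raddf0.
  rewrite hM // scale_scalar_mx mulrnAr mulVf //.
pose Pi : 'M[C]_#|O| := \sum_t c t *: (M t *m (M t) ^t*).
have PiH : Pi ^t* = Pi.
  have e (N : 'M[C]_(#|O|, #|L|)) : (N *m N ^t*) ^t* = N *m N ^t* by rewrite adjM trmxCK.
  by rewrite adj_sum; apply: eq_bigr => t _; rewrite adjZ (geC0_conj (c0 t)) e.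
have PiM t : good t -> Pi *m M t = M t.
  move=> gt; rewrite mulmx_suml (bigD1 t) //= [X in _ + X]big1 => [|t' tt'].
    by rewrite -scalemxAl -mulmxA scalemxAr MM gt eqxx mulmx1 addr0.
  by rewrite -scalemxAl -mulmxA scalemxAr MM (negPf tt') andbF raddf0 mulmx0.
have PiPi : Pi *m Pi = Pi.
  rewrite {2}/Pi mulmx_sumr; apply: eq_bigr => t _.
  rewrite -scalemxAr mulmxA /c; case: ifPn => [gt|_]; last by rewrite !scale0r.
  by rewrite PiM.
pose Q := 1%:M - Pi.
have QQ : Q *m Q = Q.
  by rewrite /Q mulmxBl mul1mx mulmxBr mulmx1 PiPi subrr subr0.
have QH : Q ^t* = Q.
  rewrite /Q -{2}PiH -{2}(adj1 R #|O|).
  by apply/matrixP => i j; rewrite !mxE rmorphB.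
pose K : finType := (T + O)%type.
pose dw (k : K) : C := if k is inl t then c t else 1.
pose D (k : K) : 'M[C]_(#|L|, #|O|) := match k with
  | inl t => (M t) ^t*
  | inr u => rop (fun (x : L) (y : O) => ((x == l0) && (y == u))%:R) *m Q
  end.
have dw0 k : 0 <= dw k by case: k.
have DD : \sum_k dw k *: ((D k) ^t* *m D k) = 1%:M.
  rewrite big_sumType /= (_ : \sum_i c i *: _ = Pi); last first.
    by apply: eq_bigr => t _; rewrite trmxCK.
  pose E u : 'M[C]_(#|L|, #|O|) := rop (fun (x : L) (y : O) => ((x == l0) && (y == u))%:R).
  have EE : \sum_u (E u) ^t* *m E u = 1%:M.
    apply: ent_inj => x y; rewrite ent_sum ent_scalar.
    rewrite (eq_bigr (fun u => ((x == u) && (y == u))%:R)) => [|u _]; last first.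
      rewrite ent_mul (bigD1 l0) //= [X in _ + X]big1 => [|z /negPf zl].
        by rewrite addr0 ent_adj !ent_rop eqxx /= rmorph_nat -natrM mulnb.
      by rewrite [ent (E u) z y]ent_rop zl mulr0.
    rewrite (bigD1 x) //= eqxx [X in _ + X]big1 => [|u /negPf ux].
      by rewrite addr0 eq_sym.
    by rewrite eq_sym ux.
  rewrite (_ : \sum_i 1 *: _ = Q); first by rewrite addrC subrK.
  rewrite -[RHS]QQ -[X in _ = X *m _]mulmx1 -EE mulmx_sumr mulmx_suml.
  apply: eq_bigr => u _; rewrite scale1r -/(E u); move: (E u) => F.
  by rewrite adjM QH !mulmxA.
have ch : quantum_channel (kraus dw D : opr R O -> opr R L) by exact: kraus_channel.
apply: le_trans (choi_error_le_dec enc noise ch) _.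
apply: ler_wsqrtr; rewrite lerD2l lerN2.
have -> : ((kraus dw D : opr R O -> opr R L) \o noise \o enc) =
   kraus (fun kt : K * T => dw kt.1 * (w kt.2)%:C) (fun kt => D kt.1 *m M kt.2).
  by apply/funext => rho; rewrite /= hN kraus_comp.
have p0 (kt : K * T) : 0 <= dw kt.1 * (w kt.2)%:C by rewrite mulr_ge0 ?ler0c.
apply: le_trans (fidelity_kraus _ L0 p0).
rewrite (_ : \sum_(t | good t) w t * nu t = complex.Re (\sum_(t | good t) (w t * nu t)%:C)); last first.
  by rewrite -rmorph_sum.
apply: Re_le.
(* All terms of the fidelity bound are nonnegative. Only those are kept in which the decoder
   operator [inl t] meets the Kraus operator of the same good [t]: there the trace is [nu t * #|L|],
   and the term equals [w t * nu t]. *)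
pose F (k : K) (t : T) : C := dw k * (w t)%:C * (`|\tr (D k *m M t)| / #|L|%:R) ^+ 2.
have F0 k t : 0 <= F k t by rewrite mulr_ge0 ?(p0 (k, t)) // exprn_ge0 // divr_ge0.
rewrite -(pair_bigA _ F) /= big_sumType /= -[X in X <= _]addr0 lerD //; last first.
  by apply: sumr_ge0 => k _; apply: sumr_ge0 => t _.
rewrite big_mkcond /=; apply: ler_sum => t _; case: ifPn => gt; last by apply: sumr_ge0.
rewrite (bigD1 t) //= -[X in X <= _]addr0 lerD //; last by apply: sumr_ge0.
rewrite le_eqVlt; apply/orP; left; apply/eqP.
rewrite /F /= /c gt hM // eqxx mulr1n mxtrace_scalar normrMn ger0_norm ?ler0c ?ltW //.
have -> : (nu t)%:C *+ #|L| / #|L|%:R = (nu t)%:C.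
  by rewrite -[X in X / _]mulr_natr mulfK // pnatr_eq0 -lt0n.
by rewrite expr2 mulrACA mulVf // mul1r rmorphM /=.
Qed.
End Recovery.

(** * Pauli labels *)

Section Pauli.
Local Open Scope sesquilinear_scope.
Local Open Scope complex_scope.
Variable R : realType.
Local Notation C := R[i].
Implicit Types Q A B D : finType.

Definition tens Q A B (F : Q -> A -> B -> C) :
    'M[C]_(#|{ffun Q -> A}|, #|{ffun Q -> B}|) :=
  rop (fun (x : {ffun Q -> A}) (y : {ffun Q -> B}) => \prod_q F q (x q) (y q)).

Lemma eq_tens Q A B (F G : Q -> A -> B -> C) :
  (forall q x y, F q x y = G q x y) -> tens F = tens G.
Proof. by move=> h; apply: ent_inj => x y; rewrite !ent_rop; apply: eq_bigr. Qed.

Lemma tens_mul Q A B D (F : Q -> A -> B -> C) (G : Q -> B -> D -> C) :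
  tens F *m tens G = tens (fun q x y => \sum_z F q x z * G q z y).
Proof.
apply: ent_inj => x y; rewrite ent_mul ent_rop bigA_distr_bigA /=.
by apply: eq_bigr => z _; rewrite !ent_rop big_split.
Qed.

Lemma tens_adj Q A B (F : Q -> A -> B -> C) :
  (tens F) ^t* = tens (fun q x y => Num.conj (F q y x)).
Proof. by apply: ent_inj => x y; rewrite ent_adj !ent_rop rmorph_prod. Qed.

Lemma tens_scale Q A B (c : Q -> C) (F : Q -> A -> B -> C) :
  tens (fun q x y => c q * F q x y) = (\prod_q c q) *: tens F.
Proof. by apply: ent_inj => x y; rewrite ent_scale !ent_rop big_split. Qed.

Lemma tens_tr Q A (F : Q -> A -> A -> C) : \tr (tens F) = \prod_q \sum_x F q x x.
Proof. by rewrite tr_ent bigA_distr_bigA /=; apply: eq_bigr => x _; rewrite ent_rop. Qed.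

Lemma tens1 Q A : tens (fun _ : Q => fun x y : A => (x == y)%:R) = 1%:M.
Proof.
apply: ent_inj => x y; rewrite ent_rop ent_scalar; case: (eqVneq x y) => [->|xy].
  by rewrite big1 // => q _; rewrite eqxx.
have [q xyq] : exists q, x q != y q.
  by apply/existsP; rewrite -negb_forall; apply: contra xy => /forallP h; apply/eqP/ffunP => q; apply/eqP.
by rewrite (bigD1 q) //= (negPf xyq) mul0r.
Qed.

Definition label Q := {ffun Q -> bool * bool}.

Definition pauli1 (a : bool * bool) (x y : bool) : C :=
  (x == y (+) a.1)%:R * (-1) ^+ (a.2 && y : bool).

Definition labmx Q (a : label Q) : 'M[C]_#|{ffun Q -> bool}| := tens (fun q => pauli1 (a q)).

Definition label0 Q : label Q := [ffun _ => (false, false)].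

Definition addl Q (a b : label Q) : label Q :=
  [ffun q => ((a q).1 (+) (b q).1, (a q).2 (+) (b q).2)].

(** Exponent of the sign that arises when the Z part of [a] moves past the X part of [b]. Its
    symmetrization [sympl] is the symplectic form, which tells whether the two Paulis
    anticommute. *)
Definition half_form Q (a b : label Q) : bool := \big[addb/false]_q ((a q).2 && (b q).1).

Definition sympl Q (a b : label Q) : bool := half_form a b (+) half_form b a.

Lemma addlC Q (a b : label Q) : addl a b = addl b a.
Proof. by apply/ffunP => q; rewrite !ffunE addbC [X in (_, X)]addbC. Qed.

Lemma addlA Q (a b c : label Q) : addl a (addl b c) = addl (addl a b) c.
Proof. by apply/ffunP => q; rewrite !ffunE /= !addbA. Qed.

Lemma addlK Q (a b : label Q) : addl a (addl a b) = b.
Proof. by apply/ffunP => q; rewrite !ffunE /= !addbA !addbb /=; case: (b q). Qed.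

Lemma addl_self Q (a : label Q) : addl a a = label0 Q.
Proof. by apply/ffunP => q; rewrite !ffunE !addbb. Qed.

Lemma addl_eq0 Q (a b : label Q) : (addl a b == label0 Q) = (a == b).
Proof.
apply/eqP/eqP => [h|->]; last exact: addl_self.
by rewrite -[b](addlK a) h; apply/ffunP => q; rewrite !ffunE /= !addbF; case: (a q).
Qed.

Lemma half_formDl Q (a b c : label Q) :
  half_form (addl a b) c = half_form a c (+) half_form b c.
Proof.
by rewrite /half_form -big_split /=; apply: eq_bigr => q _; rewrite !ffunE /= andb_addl.
Qed.

Lemma half_formDr Q (a b c : label Q) :
  half_form c (addl a b) = half_form c a (+) half_form c b.
Proof.
by rewrite /half_form -big_split /=; apply: eq_bigr => q _; rewrite !ffunE /= andb_addr.
Qed.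

Lemma symplDl Q (a b c : label Q) : sympl (addl a b) c = sympl a c (+) sympl b c.
Proof. by rewrite /sympl half_formDl half_formDr addbACA. Qed.

Lemma symplC Q (a b : label Q) : sympl a b = sympl b a.
Proof. by rewrite /sympl addbC. Qed.

Lemma sympl_self Q (a : label Q) : sympl a a = false.
Proof. by rewrite /sympl addbb. Qed.

Lemma symplDr Q (a b c : label Q) : sympl c (addl a b) = sympl c a (+) sympl c b.
Proof. by rewrite symplC symplDl !(symplC c). Qed.

Lemma sympl_nondeg Q (a : label Q) : a != label0 Q -> exists w, sympl a w.
Proof.
move=> a0; have [q aq] : exists q, a q != (false, false).
  apply/existsP; rewrite -negb_forall; apply: contra a0 => /forallP h.
  by apply/eqP/ffunP => q; rewrite ffunE; apply/eqP.
(* The witness lives on the single qubit [q]: a Z if [a] has an X factor there, an X otherwise. *)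
pose w (u : bool * bool) : label Q := [ffun q' => if q' == q then u else (false, false)].
have hw u : sympl a (w u) = ((a q).2 && u.1) (+) ((a q).1 && u.2).
  have h1 : half_form a (w u) = (a q).2 && u.1.
    rewrite /half_form (bigD1 q) //= big1 ?addbF ?ffunE ?eqxx // => q' /negPf h.
    by rewrite ffunE h andbF.
  have h2 : half_form (w u) a = u.2 && (a q).1.
    rewrite /half_form (bigD1 q) //= big1 ?addbF ?ffunE ?eqxx // => q' /negPf h.
    by rewrite ffunE h.
  by rewrite /sympl h1 h2 (andbC u.2).
case e : (a q) aq => [[] a2] // aq.
  by exists (w (false, true)); rewrite hw e /= andbF.
by case: a2 e aq => // e _; exists (w (true, false)); rewrite hw e.
Qed.

Lemma sign_half_form Q (a b : label Q) :
  \prod_q (-1) ^+ ((a q).2 && (b q).1 : bool) = (-1) ^+ (half_form a b) :> C.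
Proof.
rewrite /half_form (big_morph (fun b : bool => (-1 : C) ^+ b) (id1 := 1) (op1 := *%R)) //.
by move=> x y; rewrite signr_addb.
Qed.

Lemma pauli_mxE Q (P : pauli Q) : pauli_mx R P = 'i ^+ P.1 *: labmx P.2.
Proof. by apply: ent_inj => x y; rewrite ent_scale !ent_rop. Qed.

Lemma labmx0 Q : labmx (label0 Q) = 1%:M.
Proof.
rewrite -[RHS]tens1; apply: eq_tens => q x y.
by rewrite /pauli1 ffunE /= addbF expr0 mulr1.
Qed.

Lemma labmxM Q (a b : label Q) :
  labmx a *m labmx b = (-1) ^+ (half_form a b) *: labmx (addl a b).
Proof.
rewrite -sign_half_form -tens_scale tens_mul; apply: eq_tens => q x y.
rewrite big_bool /pauli1 !ffunE /=.
case: (a q) (b q) => [[] []] [[] []]; case: x; case: y;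
  rewrite /=; ring.
Qed.

Lemma labmx_adj Q (a : label Q) : (labmx a) ^t* = (-1) ^+ (half_form a a) *: labmx a.
Proof.
rewrite -sign_half_form -tens_scale tens_adj; apply: eq_tens => q x y.
rewrite /pauli1 rmorphM rmorph_nat rmorphXn rmorphN1.
case: (a q) => [[] []]; case: x; case: y;
  rewrite /=; ring.
Qed.

Lemma labmx_tr Q (a : label Q) : a != label0 Q -> \tr (labmx a) = 0.
Proof.
move=> a0; have [q aq] : exists q, a q != (false, false).
  apply/existsP; rewrite -negb_forall; apply: contra a0 => /forallP h.
  by apply/eqP/ffunP => q; rewrite ffunE; apply/eqP.
rewrite tens_tr (bigD1 q) //= big_bool /pauli1.
case: (a q) aq => [[] []] //= _;
  rewrite /=; ring.
Qed.

Lemma labmx_sqr Q (a : label Q) : labmx a *m labmx a = ((-1) ^+ (half_form a a))%:M.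
Proof. by rewrite labmxM addl_self labmx0 scalemx1. Qed.

Lemma labmx_unitary Q (a : label Q) : labmx a *m (labmx a) ^t* = 1%:M.
Proof.
by rewrite labmx_adj -scalemxAr labmx_sqr scale_scalar_mx -signr_addb addbb.
Qed.

Lemma imaginary_sqr : 'i ^+ 2 = -1 :> C.
Proof. by rewrite sqrCi. Qed.

Lemma iexp_mod n : ('i%R : C) ^+ n = 'i ^+ (n %% 4).
Proof.
rewrite {1}(divn_eq n 4) exprD mulnC exprM.
by rewrite (exprM _ 2 2) imaginary_sqr sqrrN !expr1n mul1r.
Qed.

Lemma neq0_iexp n : ('i%R : C) ^+ n != 0.
Proof. by rewrite expf_neq0 // neq0Ci. Qed.

Lemma iexp_inj (c d : 'I_4) : ('i%R : C) ^+ c = 'i ^+ d -> c = d.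
Proof.
have N1 : (-1 : C) != 1 by rewrite eq_sym -subr_eq0 opprK (pnatr_eq0 _ 2).
have i1 : ('i%R : C) != 1.
  by apply: contra N1 => /eqP h; rewrite -imaginary_sqr h expr1n.
move=> h; apply/val_inj; move: h.
wlog le_cd : c d / (c <= d)%N => [H|].
  by case: (leqP c d) => [/H//|/ltnW/H h /esym/h].
rewrite -(subnK le_cd) exprD -[X in X = _]mul1r => /(mulIf (neq0_iexp _)) /esym.
have : (d - c < 4)%N by apply: leq_ltn_trans (leq_subr _ _) (ltn_ord d).
case e : (d - c)%N => [|[|[|[|n]]]] // _.
- by move=> _; apply/eqP; rewrite eqn_leq le_cd -subn_eq0 e.
- by move=> h; case/eqP: i1; exact: h.
- by rewrite imaginary_sqr => h; case/eqP: N1.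
- move=> h; case/eqP: i1; transitivity (('i%R : C) ^+ 3 * 'i%R).
    by rewrite h mul1r.
  by rewrite -exprSr iexp_mod.
Qed.

(** Labels are separated by trace orthogonality, and the phases by the unitarity of [labmx]. This is
    what turns identities of matrices into identities of labels. *)
Lemma pauli_mx_inj Q : injective (@pauli_mx R Q).
Proof.
move=> [c a] [d b]; rewrite !pauli_mxE /= => h.
have ab : a = b.
  apply/eqP; rewrite -addl_eq0; apply/negPn/negP => ab.
  have := congr1 (fun M => \tr (M *m labmx b)) h.
  rewrite /= -!scalemxAl !mxtraceZ labmxM mxtraceZ labmx_tr // !mulr0 labmx_sqr mxtrace_scalar.
  move/esym/eqP; rewrite -mulr_natr !mulf_eq0 (negPf (neq0_iexp _)) /= signr_eq0 /=.
  by rewrite pnatr_eq0 card_ffun card_bool expn_eq0.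
rewrite ab in h *; congr (_, _); apply: iexp_inj.
have := congr1 (fun M => M *m (labmx b) ^t*) h.
rewrite /= -!scalemxAl labmx_unitary => /(congr1 mxtrace).
rewrite !mxtraceZ => /mulIf; apply.
by rewrite mxtrace1 pnatr_eq0 card_ffun card_bool expn_eq0.
Qed.
End Pauli.

(** * Random Clifford classes *)

Section Clifford.
Local Open Scope sesquilinear_scope.
Local Open Scope complex_scope.
Variable R : realType.
Local Notation C := R[i].
Variable Q : finType.
Implicit Types (a b : label Q) (s t : {perm pauli Q}).
Local Notation classes := (clifford_classes R Q).
Local Notation labmx := (labmx R).

Lemma unitaryV n (U : 'M[C]_n) : U \is unitarymx -> U *m U ^t* = 1%:M.
Proof. by move/unitarymxP. Qed.

Lemma unitaryK n (U : 'M[C]_n) : U \is unitarymx -> U ^t* *m U = 1%:M.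
Proof. by move/unitarymxP/mulmx1C. Qed.

Lemma clifford_perm (U : 'M[C]_#|{ffun Q -> bool}|) :
  clifford (U : opr R {ffun Q -> bool}) -> exists s, clifford_acts (U : opr R {ffun Q -> bool}) s.
Proof.
move=> cU; have [uU hU] := cU; pose f P := sval (cid (hU P)).
have hf P : U *m pauli_mx R P *m U ^t* = pauli_mx R (f P) := svalP (cid (hU P)).
have f_inj : injective f.
  move=> P P' e; apply: (@pauli_mx_inj R).
  have : U *m pauli_mx R P *m U ^t* = U *m pauli_mx R P' *m U ^t* by rewrite !hf e.
  move=> /(congr1 (fun M => U ^t* *m M *m U)).
  by rewrite !mulmxA (unitaryK uU) !mul1mx -!mulmxA (unitaryK uU) !mulmx1.
by exists (perm f_inj); split=> // P; rewrite permE hf.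
Qed.

Lemma classesP s : reflect (exists U : opr R {ffun Q -> bool}, clifford_acts U s) (s \in classes).
Proof. by rewrite inE; exact: asboolP. Qed.

Lemma clifford_reprP s : s \in classes -> clifford_acts (clifford_repr R s) s.
Proof. by move=> /classesP h; exact: (xgetPex 1%:M h). Qed.

Lemma clifford_actsI (U : 'M[C]_#|{ffun Q -> bool}|) s : U \is unitarymx ->
  (forall P, U *m pauli_mx R P *m U ^t* = pauli_mx R (s P)) ->
  clifford_acts (U : opr R {ffun Q -> bool}) s.
Proof. by move=> uU hU; split; [split; [exact: uU | move=> P; exists (s P); exact: hU] | exact: hU]. Qed.

Lemma classesV s : s \in classes -> (s^-1)%g \in classes.
Proof.
move=> /classesP[U [[uU _] hU]]; apply/classesP; exists (U ^t*).
have hV P : U ^t* *m pauli_mx R P *m (U ^t*) ^t* = pauli_mx R ((s^-1)%g P).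
  rewrite trmxCK -[X in pauli_mx R X](permKV s) -hU.
  by rewrite !mulmxA (unitaryK uU) !mul1mx -!mulmxA (unitaryK uU) !mulmx1.
apply: clifford_actsI hV; by rewrite trmxC_unitary.
Qed.

Lemma classesM s t : s \in classes -> t \in classes -> (s * t)%g \in classes.
Proof.
move=> /classesP[U [[uU _] hU]] /classesP[V [[uV _] hV]]; apply/classesP; exists (V *m U).
have hVU P : (V *m U) *m pauli_mx R P *m (V *m U) ^t* = pauli_mx R ((s * t)%g P).
  by rewrite permM -hV -hU adjM !mulmxA.
exact: clifford_actsI (mul_unitarymx uV uU) hVU.
Qed.

(** The action with phases forgotten. It is read off at phase [ord0]; conjugation being linear, any
    other phase gives the same label ([lab_actE]). *)
Definition lab_act s a : label Q := (s (ord0, a)).2.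

Lemma iexp_pauli c a : exists d : 'I_4, ('i%R : C) ^+ c *: labmx a = pauli_mx R (d, a).
Proof.
have h : (c %% 4 < 4)%N by rewrite ltn_mod.
by exists (Ordinal h); rewrite pauli_mxE /= iexp_mod.
Qed.

Lemma lab_actE s c a : s \in classes -> (s (c, a)).2 = lab_act s a.
Proof.
move=> /classesP[U [_ hU]]; have := hU (c, a); rewrite pauli_mxE /=.
have := hU (ord0, a); rewrite pauli_mxE /= expr0 scale1r -scalemxAr -scalemxAl => ->.
rewrite pauli_mxE scalerA -exprD; have [d ->] := iexp_pauli (c + (s (ord0, a)).1) (s (ord0, a)).2.
by move/pauli_mx_inj <-.
Qed.

Lemma lab_actM s t a : s \in classes -> t \in classes ->
  lab_act (s * t)%g a = lab_act t (lab_act s a).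
Proof.
move=> hs ht; rewrite {1}/lab_act permM [s _]surjective_pairing.
by rewrite lab_actE.
Qed.

Lemma lab_actK s : s \in classes -> cancel (lab_act s) (lab_act (s^-1)%g).
Proof.
move=> hs a; rewrite -lab_actM ?classesV // mulgV /lab_act perm1 //.
Qed.

Lemma lab_actVK s : s \in classes -> cancel (lab_act (s^-1)%g) (lab_act s).
Proof.
move=> hs a; rewrite -lab_actM ?classesV // mulVg /lab_act perm1 //.
Qed.

Lemma lab_act0 s : s \in classes -> lab_act s (label0 Q) = label0 Q.
Proof.
move=> /classesP[U [[uU _] hU]]; have := hU (ord0, label0 Q).
have e : pauli_mx R (ord0, label0 Q) = 1%:M by rewrite pauli_mxE expr0 scale1r labmx0.
rewrite e mulmx1 unitaryV // -{1}e => /pauli_mx_inj h.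
by rewrite /lab_act -h.
Qed.

Lemma lab_act_eq0 s a : s \in classes -> (lab_act s a == label0 Q) = (a == label0 Q).
Proof.
move=> hs; apply/eqP/eqP => [h|->]; last exact: lab_act0.
by rewrite -[a](lab_actK hs) h lab_act0 // classesV.
Qed.

(** When [X] squares to -1, [1 - X] is up to a scalar the rotation [exp(- pi X / 4)]. A Pauli
    commutes or anticommutes with a Pauli [X], and this lemma and the next treat the two cases. *)
Lemma conj_commute n (X M : 'M[C]_n) : X *m X = - 1%:M -> X *m M = M *m X ->
  (1%:M - X) *m M *m (1%:M + X) = 2 *: M.
Proof.
move=> XX XM; rewrite mulmxBl mul1mx XM mulmxDr mulmx1 mulmxBl -mulmxA XX mulmxN mulmx1 opprK.
by rewrite addrA subrK scaler_nat mulr2n.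
Qed.

Lemma conj_anticommute n (X M : 'M[C]_n) : X *m X = - 1%:M -> X *m M = - (M *m X) ->
  (1%:M - X) *m M *m (1%:M + X) = 2 *: (M *m X).
Proof.
move=> XX XM; rewrite mulmxBl mul1mx XM opprK mulmxDr mulmx1 mulmxDl -mulmxA XX mulmxN mulmx1.
by rewrite [Y in Y + _]addrC addrACA subrr addr0 scaler_nat mulr2n.
Qed.

(* [U = (1 + i)/2 (1 - i h)], with [h] the Hermitian Pauli of label [a]; it acts on
   labels as the symplectic transvection of [a]. *)
Lemma transvection a : exists2 s, s \in classes &
  forall b, lab_act s b = if sympl a b then addl a b else b.
Proof.
(* The matrix [labmx a] squares to 1 or -1 according to [half_form a a]; this power of ['i] makes
   [X] square to -1 in both cases. *)
pose X : 'M[C]_#|{ffun Q -> bool}| := 'i%R ^+ (half_form a a).+1 *: labmx a.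
have XX : X *m X = - 1%:M.
  rewrite -scalemxAl -scalemxAr labmx_sqr scalerA scale_scalar_mx -exprD.
  rewrite addSnnS -addSnnS addnn -mul2n exprM imaginary_sqr -exprD addSn addnn -mul2n.
  by rewrite exprS exprM sqrrN !expr1n mulr1 raddfN.
have XH : X ^t* = - X.
  rewrite adjZ labmx_adj scalerA rmorphXn /= conjCi -scaleNr; congr (_ *: _).
  by case: (half_form a a); ring.
(* Only [c * Num.conj c = 2^-1] matters; this choice avoids the square root of 2. *)
pose c : C := (1 + 'i%R) / 2.
pose U : 'M[C]_#|{ffun Q -> bool}| := c *: (1%:M - X).
have UH : U ^t* = Num.conj c *: (1%:M + X).
  by rewrite adjZ adjD adj1 -scaleN1r adjZ XH rmorphN1 scaleN1r opprK.
have cc : c * Num.conj c = 2^-1.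
  rewrite rmorphM fmorphV rmorph_nat rmorphD rmorph1 /= conjCi mulrACA.
  have := imaginary_sqr R; move: ('i%R : C) => i ii; have -> : (1 + i) * (1 - i) = 1 - i ^+ 2 by ring.
  by rewrite ii; field.
have mid M : U *m M *m U ^t* = 2^-1 *: ((1%:M - X) *m M *m (1%:M + X)).
  by rewrite UH -!scalemxAl -scalemxAr scalerA cc.
have half M : 2^-1 *: (2 *: M) = M :> 'M[C]_#|{ffun Q -> bool}|.
  by rewrite scalerA mulVf ?pnatr_eq0 // scale1r.
have uU : U \is unitarymx.
  apply/unitarymxP; rewrite -[X in X *m _]mulmx1 mid conj_commute ?half //.
  by rewrite mul1mx mulmx1.
have com b : X *m labmx b = (-1) ^+ (sympl a b) *: (labmx b *m X).
  rewrite /X -scalemxAl -scalemxAr !labmxM !scalerA addlC; congr (_ *: _).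
  rewrite [RHS]mulrAC [RHS]mulrC; congr (_ * _).
  rewrite -signr_addb; congr (_ ^+ (nat_of_bool _)).
  by rewrite /sympl -addbA addbb addbF.
have act b : U *m labmx b *m U ^t* = if sympl a b then
    ((-1) ^+ half_form b a * 'i%R ^+ (half_form a a).+1) *: labmx (addl a b) else labmx b.
  rewrite mid; case: ifP (com b) => [_|_].
    rewrite expr1 scaleN1r => h; rewrite conj_anticommute // half.
    by rewrite -scalemxAr labmxM scalerA addlC mulrC.
  by rewrite expr0 scale1r => h; rewrite conj_commute.
have actP (P : pauli Q) : exists P', U *m pauli_mx R P *m U ^t* = pauli_mx R P' /\
    P'.2 = if sympl a P.2 then addl a P.2 else P.2.
  case: P => d b; rewrite pauli_mxE -scalemxAr -scalemxAl act /=; case: ifP => _.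
    rewrite scalerA; set z := _ * _.
    have [e ->] : exists e : nat, z = 'i%R ^+ e.
      exists (d + (2 * half_form b a + (half_form a a).+1))%N.
      by rewrite /z exprD [Y in _ = _ * Y]exprD exprM imaginary_sqr.
    by have [d' ->] := iexp_pauli e (addl a b); exists (d', addl a b).
  by exists (d, b); rewrite pauli_mxE.
have cU : clifford (U : opr R {ffun Q -> bool}).
  by split=> // P; have [P' [h _]] := actP P; exists P'.
have [s hs] := clifford_perm cU; exists s; first by apply/classesP; exists U.
move=> b; have [P' [h hP']] := actP (ord0, b).
by rewrite /lab_act; have := hs.2 (ord0, b); rewrite h => /pauli_mx_inj <-.
Qed.

(** If [u] and [v] anticommute, the transvection of [u + v] takes [u] to [v]. In general one passes
    through some [w] that anticommutes with both [a] and [b]: one of the two nondegeneracy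
    witnesses, or else their sum. *)
Lemma lab_act_trans a b : a != label0 Q -> b != label0 Q ->
  exists2 s, s \in classes & lab_act s a = b.
Proof.
have step u v : sympl u v -> exists2 s, s \in classes & lab_act s u = v.
  move=> uv; have [s hs hact] := transvection (addl u v); exists s => //.
  by rewrite hact symplDl sympl_self symplC uv /= addlC addlA addl_self addlC;
    apply/ffunP => q; rewrite !ffunE !addbF; case: (v q).
move=> a0 b0; suff [w aw bw] : exists2 w, sympl a w & sympl b w.
  have [s hs sa] := step _ _ aw.
  have [t ht <-] : exists2 t, t \in classes & lab_act t w = b by apply: step; rewrite symplC.
  by exists (s * t)%g; rewrite ?classesM ?lab_actM ?sa.
have [w1 aw1] := sympl_nondeg a0; have [w2 bw2] := sympl_nondeg b0.
case bw1 : (sympl b w1); first by exists w1.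
case aw2 : (sympl a w2); first by exists w2.
by exists (addl w1 w2); rewrite symplDr ?aw1 ?aw2 ?bw1 ?bw2.
Qed.

Lemma classes_gt0 : (0 < #|classes|)%N.
Proof.
apply/card_gt0P; exists 1%g; apply/classesP; exists 1%:M.
by apply: clifford_actsI => [|P]; rewrite ?adj1 ?mul1mx ?mulmx1 ?perm1 //; apply/unitarymxP;
  rewrite adj1 mulmx1.
Qed.

Lemma card_label : #|{: label Q}| = (4 ^ #|Q|)%N.
Proof. by rewrite card_ffun card_prod card_bool. Qed.

Lemma sum_lab_act_const a b (f : label Q -> R) : a != label0 Q -> b != label0 Q ->
  \sum_(s in classes) f (lab_act (s^-1)%g a) = \sum_(s in classes) f (lab_act (s^-1)%g b).
Proof.
move=> a0 b0; have [t ht <-] := lab_act_trans a0 b0.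
rewrite [RHS](reindex_inj (mulIg t)) /=.
have tC s : ((s * t)%g \in classes) = (s \in classes).
  apply/idP/idP => [h|h]; last exact: classesM.
  by rewrite -[s](mulgK t); apply: classesM => //; exact: classesV.
rewrite (eq_bigl _ _ tC); apply: eq_bigr => s hs.
by rewrite -lab_actM ?classesV ?tC // invMg mulgA mulgV mul1g.
Qed.

(** By transitivity the sum over classes is the same for every nonzero [a]. It is therefore summed
    over all [4^#|Q| - 1] nonzero labels; after exchanging the sums, each class merely permutes
    these labels. *)
Lemma avg_lab_act a (f : label Q -> R) : a != label0 Q ->
  (4 ^+ #|Q| - 1) * \sum_(s in classes) f (lab_act (s^-1)%g a) =
  #|classes|%:R * \sum_(b | b != label0 Q) f b.
Proof.
move=> a0; transitivity (\sum_(b | b != label0 Q) \sum_(s in classes) f (lab_act (s^-1)%g b)).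
  rewrite [RHS](eq_bigr (fun _ => \sum_(s in classes) f (lab_act (s^-1)%g a))) => [|b b0]; last first.
    exact: sum_lab_act_const.
  rewrite (eq_bigl (mem (predC1 (label0 Q)))) // [RHS]sumr_const -[RHS]mulr_natl; congr (_ * _).
  have -> : #|mem (predC1 (label0 Q))| = (4 ^ #|Q|).-1.
    by have := cardC1 (label0 Q); rewrite /= card_label.
  by rewrite -subn1 natrB ?expn_gt0 // natrX.
rewrite exchange_big /= [RHS]mulr_natl -sumr_const; apply: eq_bigr => s hs.
rewrite [RHS](reindex_inj (can_inj (lab_actVK hs))) /=; apply: eq_bigl => b.
by rewrite lab_act_eq0 ?classesV.
Qed.
End Clifford.

(** * Gates and layers *)

Section Gates.
Local Open Scope sesquilinear_scope.
Local Open Scope complex_scope.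
Variable R : realType.
Local Notation C := R[i].
Local Notation labmx := (labmx R).

(* The phase [c] is existential: whether an encoded operator vanishes does not depend on it. *)
Definition conj_lab (Q : finType) (U : 'M[C]_#|{ffun Q -> bool}|) (a b : label Q) : Prop :=
  exists c : C, U ^t* *m labmx a *m U = c *: labmx b.

Lemma conj_lab1 (Q : finType) (a : label Q) : conj_lab 1%:M a a.
Proof. by exists 1; rewrite adj1 mul1mx mulmx1 scale1r. Qed.

Lemma conj_labM (Q : finType) (U V : 'M[C]_#|{ffun Q -> bool}|) (a b d : label Q) :
  conj_lab U a b -> conj_lab V b d -> conj_lab (U *m V) a d.
Proof.
move=> [x hU] [y hV]; exists (x * y).
rewrite adjM (_ : _ *m (U *m V) = V ^t* *m (U ^t* *m labmx a *m U) *m V); last by rewrite !mulmxA.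
by rewrite hU -scalemxAr -scalemxAl hV scalerA.
Qed.

Section Embedding.
Variables (Q Q' : finType) (e : Q -> Q').
Hypothesis e_inj : injective e.

Definition restr T (x : {ffun Q' -> T}) : {ffun Q -> T} := [ffun q => x (e q)].

Lemma prod_codom (F : Q' -> C) : \prod_(q' | q' \in codom e) F q' = \prod_q F (e q).
Proof.
rewrite -big_uniq; first by rewrite big_map big_enum.
by rewrite map_inj_uniq ?enum_uniq.
Qed.

(** A configuration on [Q'] amounts to one on the image of [e] and free bits elsewhere. The fibre
    above [w] is cut out by one condition [P] per qubit, so its sum distributes into a product. *)
Lemma sum_restr (g : {ffun Q -> bool} -> C) (h : Q' -> bool -> C) :
  \sum_(z : {ffun Q' -> bool}) g (restr z) * \prod_(q' | q' \notin codom e) h q' (z q') =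
  (\sum_w g w) * \prod_(q' | q' \notin codom e) \sum_b h q' b.
Proof.
rewrite (partition_big (@restr bool) predT) //= mulr_suml; apply: eq_bigr => w _.
under eq_bigr => z /eqP -> do [].
rewrite -mulr_sumr; congr (_ * _).
pose F q' b : C := if q' \in codom e then 1 else h q' b.
pose P q' : pred bool := fun b => [forall q, (e q == q') ==> (b == w q)].
transitivity (\prod_q' \sum_(b | P q' b) F q' b).
  rewrite bigA_distr_big_dep /=; apply: eq_big => z.
    apply/eqP/familyP => [zw q'|H].
      by apply/forallP => q; apply/implyP => /eqP <-; rewrite -zw ffunE.
    by apply/ffunP => q; rewrite ffunE; have /forallP/(_ q)/implyP/(_ (eqxx _))/eqP := H (e q).
  by move=> _; rewrite big_mkcond; apply: eq_bigr => q' _; rewrite /F; case: ifPn => [/negPf ->|/negPn ->].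
rewrite [RHS]big_mkcond; apply: eq_bigr => q' _; rewrite /F; case: ifPn => [nq|].
  apply: eq_big => [b|b _]; last by rewrite (negPf nq).
  apply/forallP => q; apply/implyP => /eqP eq.
  by rewrite -eq codom_f in nq.
move/negPn => qc; rewrite qc; have [q eq] := codomP qc.
rewrite (big_pred1 (w q)) // => b.
apply/forallP/eqP => [/(_ q)|-> q0]; first by rewrite eq eqxx => /eqP.
by rewrite eq (inj_eq e_inj); apply/implyP => /eqP ->.
Qed.

(** Common form of embedded gates and of Paulis: an arbitrary operator on the image of [e],
    single-qubit factors outside. Conjugation can then be computed on each side separately. *)
Definition extop (A : 'M[C]_#|{ffun Q -> bool}|) (F : Q' -> bool -> bool -> C) :
    'M[C]_#|{ffun Q' -> bool}| :=
  rop (fun x y : {ffun Q' -> bool} => ent A (restr x) (restr y) *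
    \prod_(q' | q' \notin codom e) F q' (x q') (y q')).

Lemma extopM A B F G : extop A F *m extop B G =
  extop (A *m B) (fun q' x y => \sum_z F q' x z * G q' z y).
Proof.
apply: ent_inj => x y; rewrite ent_mul ent_rop ent_mul.
rewrite -(sum_restr (fun w => ent A (restr x) w * ent B w (restr y))
   (fun q' b => F q' (x q') b * G q' b (y q'))).
by apply: eq_bigr => z _; rewrite !ent_rop mulrACA -big_split.
Qed.

Lemma extop_adj A F : (extop A F) ^t* = extop (A ^t*) (fun q' x y => Num.conj (F q' y x)).
Proof.
by apply: ent_inj => x y; rewrite ent_adj !ent_rop rmorphM rmorph_prod ent_adj.
Qed.

Lemma extop_scale c A F : extop (c *: A) F = c *: extop A F.
Proof. by apply: ent_inj => x y; rewrite ent_scale !ent_rop ent_scale mulrA. Qed.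

Lemma eq_extop A F G : (forall q' x y, F q' x y = G q' x y) -> extop A F = extop A G.
Proof.
by move=> h; apply: ent_inj => x y; rewrite !ent_rop; congr (_ * _); apply: eq_bigr.
Qed.

Lemma gate_onE (A : 'M[C]_#|{ffun Q -> bool}|) :
  gate_on e (A : opr R {ffun Q -> bool}) = extop A (fun _ x y => (x == y)%:R).
Proof.
apply: ent_inj => x y; rewrite !ent_rop -/(restr x) -/(restr y) /entry -/(ent _ _ _).
case: ifPn => [/forallP h|].
  by rewrite big1 ?mulr1 // => q' nq; have /implyP/(_ nq)/eqP -> := h q'; rewrite eqxx.
rewrite negb_forall => /existsP[q']; rewrite negb_imply => /andP[nq xy].
by rewrite (bigD1 q') //= (negPf xy) mul0r mulr0.
Qed.

Lemma labmx_extop (b : label Q') : labmx b = extop (labmx (restr b)) (fun q' => pauli1 R (b q')).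
Proof.
apply: ent_inj => x y; rewrite !ent_rop (bigID (mem (codom e))) /= prod_codom.
by congr (_ * _); apply: eq_bigr => q _; rewrite !ffunE.
Qed.

Definition upd (g : label Q -> label Q) (b : label Q') : label Q' :=
  [ffun q' => if [pick q | e q == q'] is Some q then g (restr b) q else b q'].

Lemma upd_in g b q : upd g b (e q) = g (restr b) q.
Proof.
rewrite ffunE; case: pickP => [q0 /eqP/e_inj -> //|/(_ q)].
by rewrite eqxx.
Qed.

Lemma upd_out g b q' : q' \notin codom e -> upd g b q' = b q'.
Proof.
by move=> nq; rewrite ffunE; case: pickP => // q /eqP eq; rewrite -eq codom_f in nq.
Qed.

Lemma restr_upd g b : restr (upd g b) = g (restr b).
Proof. by apply/ffunP => q; rewrite ffunE upd_in. Qed.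

Lemma gate_on_conj (A : 'M[C]_#|{ffun Q -> bool}|) g b : conj_lab A (restr b) (g (restr b)) ->
  conj_lab (gate_on e (A : opr R {ffun Q -> bool})) b (upd g b).
Proof.
move=> [c hc]; exists c; rewrite gate_onE extop_adj (labmx_extop b) !extopM hc extop_scale.
congr (_ *: _); rewrite (labmx_extop (upd g b)) restr_upd.
apply: ent_inj => x y; rewrite !ent_rop; congr (_ * _); apply: eq_bigr => q' nq.
rewrite upd_out // (bigD1 (y q')) //= eqxx mulr1 [Y in _ + Y]big1 ?addr0 => [|z /negPf ->]; last first.
  by rewrite mulr0.
rewrite (bigD1 (x q')) //= eqxx rmorph1 mul1r big1 ?addr0 // => z /negPf ->.
by rewrite rmorph0 mul0r.
Qed.

Lemma gate_on_iso (A : 'M[C]_#|{ffun Q -> bool}|) : A ^t* *m A = 1%:M ->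
  (gate_on e (A : opr R {ffun Q -> bool})) ^t* *m gate_on e (A : opr R {ffun Q -> bool}) = 1%:M.
Proof.
move=> hA; rewrite gate_onE extop_adj extopM hA -[RHS]labmx0 (labmx_extop (label0 Q')).
have -> : restr (label0 Q') = label0 Q by apply/ffunP => q; rewrite !ffunE.
rewrite labmx0; apply: eq_extop => q x y; rewrite big_bool /pauli1 ffunE.
by case: x; case: y; rewrite /= !rmorph_nat; ring.
Qed.
End Embedding.

(** The inverse permutation appears because labels evolve in the Heisenberg picture, by the adjoint
    on the left and [U] on the right. *)
Lemma clifford_repr_conj (Q : finType) (s : {perm pauli Q}) (a : label Q) :
  s \in clifford_classes R Q -> conj_lab (clifford_repr R s) a (lab_act (s^-1)%g a).
Proof.
move=> /clifford_reprP [[uU _] hU]; set U := clifford_repr R s in uU hU *.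
pose P : pauli Q := (s^-1)%g (ord0, a); exists ('i%R ^+ P.1).
have := hU P; rewrite permKV !pauli_mxE expr0 scale1r => <-.
by rewrite !mulmxA unitaryK // mul1mx -mulmxA unitaryK // mulmx1.
Qed.

Section Layers.
Variables (J Q Q' : finType) (e : J -> Q -> Q').
Hypothesis e_inj : forall j, injective (e j).
Variables (s : J -> {perm pauli Q}).

(** A left fold, since conjugating by [U *m V] transforms the label by the left factor [U] first. *)
Definition apply_gates (js : seq J) (a : label Q') : label Q' :=
  foldl (fun b j => upd (e j) (lab_act (s j)^-1%g) b) a js.

Lemma layer_conj (js : seq J) (P : pred J) a :
  (forall j, s j \in clifford_classes R Q) ->
  conj_lab (\big[mulmx/1%:M]_(j <- js | P j) gate_on (e j) (clifford_repr R (s j))) a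
    (apply_gates [seq j <- js | P j] a).
Proof.
move=> hs; elim: js a => [|j js IH] a; first by rewrite big_nil; exact: conj_lab1.
rewrite big_cons /=; case: ifP => _; last exact: IH.
by apply: conj_labM (IH _); apply: gate_on_conj => //; exact: clifford_repr_conj.
Qed.

Lemma layer_iso (js : seq J) (P : pred J) :
  (forall j, s j \in clifford_classes R Q) ->
  let U := \big[mulmx/1%:M]_(j <- js | P j) gate_on (e j) (clifford_repr R (s j)) in
  U ^t* *m U = 1%:M.
Proof.
move=> hs /=; elim: js => [|j js IH]; first by rewrite big_nil adj1 mulmx1.
rewrite big_cons; case: ifP => // _; rewrite adjM mulmxA -(mulmxA (_ ^t*)) gate_on_iso //.
  by rewrite mulmx1.
by have [[uU _] _] := clifford_reprP (hs j); exact: unitaryK.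
Qed.

Lemma apply_gates_out js a q' : (forall j q, j \in js -> e j q != q') ->
  apply_gates js a q' = a q'.
Proof.
elim: js a => //= j js IH a h; rewrite IH; last first.
  by move=> j' q hj; apply: h; rewrite inE hj orbT.
rewrite upd_out //; apply/negP => /codomP[q hq].
by have := h j q; rewrite inE eqxx hq eqxx => /(_ isT).
Qed.

Lemma apply_gates_in js a j q : uniq js -> j \in js ->
  {in js &, forall j j', forall q q', e j q = e j' q' -> j = j'} ->
  apply_gates js a (e j q) = lab_act (s j)^-1%g (restr (e j) a) q.
Proof.
elim: js a => //= j0 js IH a /andP[nj ujs] hj e_disj.
have {}IH := IH _ ujs _ (sub_in2 _ e_disj); move: hj; rewrite inE => /orP[/eqP ->|hj].
  rewrite apply_gates_out ?upd_in // => j' q' hj'; apply: contra nj => /eqP h.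
  by rewrite -(e_disj j' j0 _ _ _ _ h) // inE ?hj' ?eqxx ?orbT.
rewrite IH //; last by move=> j1 h1; rewrite inE h1 orbT.
congr (lab_act _ _ q); apply/ffunP => q0; rewrite !ffunE.
case: pickP => // q1 /eqP h; suff ej : j0 = j by rewrite ej hj in nj.
by apply: e_disj h; rewrite inE ?hj ?eqxx ?orbT.
Qed.
End Layers.
End Gates.

(** * Erasure patterns *)

Section Erasure.
Local Open Scope sesquilinear_scope.
Local Open Scope complex_scope.
Variable R : realType.
Local Notation C := R[i].
Local Notation labmx := (labmx R).
Variable p : R.
Hypothesis p01 : 0 <= p <= 1.

(* [k = None] keeps the qubit, [k = Some b] is [|2><b|]; the probabilities are kept apart
   in [erase_weight1]. *)
Definition erase_kraus1 (k u : option bool) (x : bool) : C :=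
  if k is Some b then ((u == None) && (x == b))%:R else (u == Some x)%:R.

Definition erase_kraus (Q : finType) (t : {ffun Q -> option bool}) :
    'M[C]_(#|{ffun Q -> option bool}|, #|{ffun Q -> bool}|) :=
  tens (fun q => erase_kraus1 (t q)).

Definition erase_weight1 (k : option bool) : R := if k is Some _ then p else 1 - p.

Lemma sum_option_bool (S : nmodType) (F : option bool -> S) :
  \sum_k F k = F None + (F (Some true) + F (Some false)).
Proof.
rewrite (bigD1 None) //= (bigD1 (Some true)) //= (bigD1 (Some false)) //= big1 ?addr0 //.
by case=> [[]|].
Qed.

Lemma entryE (B : finType) (M : opr R B) x y : entry M x y = ent M x y.
Proof. by []. Qed.

Lemma erasure_kraus1 (x y : bool) (u v : option bool) :
  entry (erasure p (mkop (fun a b : bool => ((a == x) && (b == y))%:R : C))) u v =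
  \sum_k (erase_weight1 k)%:C * (erase_kraus1 k u x * Num.conj (erase_kraus1 k v y)).
Proof.
rewrite sum_option_bool entryE /erasure [LHS]ent_rop /= !rmorph_nat.
have tr : \tr (mkop (fun a b : bool => ((a == x) && (b == y))%:R : C)) = (x == y)%:R.
  by rewrite tr_ent big_bool !ent_rop; case: x; case: y; rewrite /= ?addr0 ?add0r.
case: u => [u|]; case: v => [v|] /=; rewrite ?tr ?entryE ?ent_rop; clear tr.
- by case: u; case: x; case: v; case: y; rewrite /=; ring.
- by rewrite !mul0r !mulr0 !addr0.
- by rewrite !mul0r !mulr0 !addr0.
- by case: x; case: y; rewrite /=; ring.
Qed.

(** Distributing the product of the one-qubit Kraus sums gives one Kraus operator per pattern [t],
    which records the erased qubits together with a basis outcome for each of them. *)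
Lemma tensor_power_erasure (Q : finType) (rho : opr R {ffun Q -> bool}) :
  tensor_power (erasure p) rho =
  kraus (fun t : {ffun Q -> option bool} => (\prod_q erase_weight1 (t q))%:C)
    (@erase_kraus Q) rho.
Proof.
apply: ent_inj => u v; rewrite ent_rop ent_sum.
transitivity (\sum_x \sum_y \sum_(t : {ffun Q -> option bool}) ent rho x y *
   \prod_q ((erase_weight1 (t q))%:C * (erase_kraus1 (t q) (u q) (x q) *
      Num.conj (erase_kraus1 (t q) (v q) (y q))))).
  apply: eq_bigr => x _; apply: eq_bigr => y _; rewrite -mulr_sumr; congr (_ * _).
  rewrite (eq_bigr _ (fun q _ => erasure_kraus1 _ _ _ _)).
  exact: bigA_distr_bigA.
under eq_bigr do rewrite exchange_big.
rewrite exchange_big; apply: eq_bigr => t _; rewrite ent_scale ent_mul.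
rewrite [X in _ = _ * X](eq_bigr (fun y => \sum_x ent (erase_kraus t) u x * ent rho x y *
   ent ((erase_kraus t) ^t*) y v)) => [|y _]; last by rewrite ent_mul mulr_suml.
rewrite [X in _ = _ * X]exchange_big mulr_sumr; apply: eq_bigr => x _.
rewrite mulr_sumr; apply: eq_bigr => y _.
rewrite ent_adj !ent_rop !big_split /= rmorph_prod rmorph_prod.
rewrite [LHS]mulrCA; congr (_ * _).
by rewrite [LHS]mulrA [X in X * _]mulrC.
Qed.

Lemma tens_sum (Q A B Z : finType) (F : Q -> Z -> A -> B -> C) :
  tens (fun q x y => \sum_z F q z x y) = \sum_(f : {ffun Q -> Z}) tens (fun q => F q (f q)).
Proof.
apply: ent_inj => x y; rewrite ent_rop ent_sum bigA_distr_bigA.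
by apply: eq_bigr => f _; rewrite ent_rop.
Qed.


Definition unit_coef (k k' : option bool) (z : bool) : C :=
  match k, k' with
  | None, None => (~~ z)%:R
  | Some _, Some b => (-1) ^+ (z && b : bool) / 2
  | _, _ => 0
  end.

Definition unit_shift (k k' : option bool) : bool :=
  if k is Some b then (if k' is Some b' then b (+) b' else false) else false.

(* [|b><b'| = (1/2) sum_z (-1)^(z b') X^(b + b') Z^z], and zero if only one of the two
   Kraus operators is an erasure. *)
Lemma erase_kraus1_unit (k k' : option bool) (x y : bool) :
  \sum_u Num.conj (erase_kraus1 k u x) * erase_kraus1 k' u y =
  \sum_z unit_coef k k' z * pauli1 R (unit_shift k k', z) x y.
Proof.
rewrite sum_option_bool big_bool /pauli1.
case: k => [b|]; case: k' => [b'|] /=; rewrite !rmorph_nat /=.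
- by case: x; case: y; case: b; case: b'; rewrite /=; field.
- by case: x; case: y; case: b; rewrite /=; ring.
- by case: x; case: y; case: b'; rewrite /=; ring.
- by case: x; case: y; rewrite /=; ring.
Qed.

(** Equal to [2^-e] with [e] erased qubits: the probability of one outcome when those qubits are
    maximally mixed. *)
Definition pattern_size_weight (Q : finType) (t : {ffun Q -> option bool}) : R :=
  \prod_q (if t q is Some _ then 2^-1 else 1).

(** Knill-Laflamme conditions. Patterns with different erased sets give product zero. With equal
    erased sets the product expands into Paulis supported on that set, of which [V] leaves only the
    identity; and the identity occurs only when the outcomes agree, because differing outcomes
    produce an X factor. *)
Lemma erase_kraus_ortho (Q L : finType) (V : 'M[C]_(#|{ffun Q -> bool}|, #|L|))
    (t t' : {ffun Q -> option bool}) :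
  V ^t* *m V = 1%:M ->
  (forall a : label Q, a != label0 Q -> (forall q, t q = None -> a q = (false, false)) ->
    V ^t* *m labmx a *m V = 0) ->
  (erase_kraus t *m V) ^t* *m (erase_kraus t' *m V) =
    ((pattern_size_weight t)%:C *+ (t == t'))%:M.
Proof.
move=> VV good; rewrite adjM mulmxA -(mulmxA (V ^t*)) tens_adj tens_mul.
rewrite (eq_tens (fun q x y => erase_kraus1_unit (t q) (t' q) x y)) tens_sum.
rewrite mulmx_sumr mulmx_suml.
pose a (z : {ffun Q -> bool}) : label Q := [ffun q => (unit_shift (t q) (t' q), z q)].
have aE (z : {ffun Q -> bool}) : tens (fun q => pauli1 R (unit_shift (t q) (t' q), z q)) = labmx (a z).
  by apply: eq_tens => q x y; rewrite ffunE.
rewrite (eq_bigr (fun z : {ffun Q -> bool} => (\prod_q unit_coef (t q) (t' q) (z q)) *: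
    (V ^t* *m labmx (a z) *m V))) => [|z _]; last first.
  by rewrite tens_scale aE -scalemxAr -scalemxAl.
pose z0 : {ffun Q -> bool} := [ffun _ => false].
(* A nonzero coefficient forces every qubit kept by [t] to be kept by [t'] and to carry no Z, so
   [a z] is supported on the qubits erased by [t]. *)
have supp (z : {ffun Q -> bool}) : \prod_q unit_coef (t q) (t' q) (z q) != 0 ->
    forall q, t q = None -> t' q = None /\ z q = false.
  move=> /prodf_neq0 h q tq; have := h q isT; rewrite tq /=.
  by case: (t' q) => [b|]; rewrite ?eqxx //; case: (z q); rewrite ?eqxx.
have vanish z : z != z0 -> (\prod_q unit_coef (t q) (t' q) (z q)) *: (V ^t* *m labmx (a z) *m V) = 0.
  move=> zz; case: (eqVneq (\prod_q unit_coef (t q) (t' q) (z q)) 0) => [->|/supp h].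
    by rewrite scale0r.
  rewrite good ?scaler0 //.
    apply: contra zz => /eqP az; apply/eqP/ffunP => q; rewrite ffunE.
    by have := congr1 (fun f : label Q => (f q).2) az; rewrite /= !ffunE.
  by move=> q tq; rewrite ffunE tq /=; have [_ ->] := h q tq.
rewrite (bigD1 z0) //= [X in _ + X]big1 ?addr0; last by move=> z; exact: vanish.
case: (eqVneq t t') => [ett|tt'].
  rewrite (_ : a z0 = label0 Q) ?labmx0 ?mulmx1 ?VV ?scalemx1 ?mulr1n.
    congr (_%:M); rewrite rmorph_prod; apply: eq_bigr => q _; rewrite ffunE -ett.
    by case: (t q) => [b|] //=; rewrite expr0 mul1r rmorphV ?unitfE ?pnatr_eq0 // rmorph_nat.
  by apply/ffunP => q; rewrite !ffunE -ett; case: (t q) => [[]|].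
rewrite mulr0n raddf0.
have [q tq] : exists q, t q != t' q.
  apply/existsP; rewrite -negb_forall; apply: contra tt' => /forallP h.
  by apply/eqP/ffunP => q; apply/eqP.
case: (eqVneq (\prod_q unit_coef (t q) (t' q) (z0 q)) 0) => [->|h]; first by rewrite scale0r.
rewrite good ?scaler0 //; last first.
  by move=> q' tq'; rewrite !ffunE tq'.
apply/eqP => /(congr1 (fun f : label Q => (f q).1)); rewrite /= !ffunE /=.
have /prodf_neq0/(_ q isT) := h.
case: (t q) (t' q) tq => [b|] [b'|] //=; rewrite ?eqxx //.
by case: b; case: b'.
Qed.

(** Each of the two outcomes on an erased qubit takes half of [p]. *)
Definition pattern_prob (Q : finType) (t : {ffun Q -> option bool}) : R :=
  \prod_q (if t q is Some _ then p / 2 else 1 - p).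

Lemma pattern_probE (Q : finType) (t : {ffun Q -> option bool}) :
  (\prod_q erase_weight1 (t q)) * pattern_size_weight t = pattern_prob t.
Proof.
rewrite -big_split; apply: eq_bigr => q _ /=.
by case: (t q) => [b|] //=; rewrite mulr1.
Qed.

Lemma pattern_prob_ge0 (Q : finType) (t : {ffun Q -> option bool}) : 0 <= pattern_prob t.
Proof. by apply: prodr_ge0 => q _; case: (t q) => [_|]; move: p01; lra. Qed.

Lemma pattern_prob_sum (Q : finType) : \sum_(t : {ffun Q -> option bool}) pattern_prob t = 1.
Proof.
rewrite -(bigA_distr_bigA (fun (q : Q) (k : option bool) => if k is Some _ then p / 2 else 1 - p)).
by rewrite big1 // => q _; rewrite sum_option_bool; field.
Qed.

Lemma choi_error_erasure (Q L : finType) (V : 'M[C]_(#|{ffun Q -> bool}|, #|L|))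
    (enc : opr R L -> opr R {ffun Q -> bool}) (good : pred {ffun Q -> option bool}) :
  (0 < #|L|)%N -> V ^t* *m V = 1%:M -> (forall rho, enc rho = V *m rho *m V ^t*) ->
  (forall t, good t -> forall a : label Q, a != label0 Q ->
    (forall q, t q = None -> a q = (false, false)) -> V ^t* *m labmx a *m V = 0) ->
  choi_error enc (tensor_power (erasure p)) <=
    Num.sqrt (\sum_(t | ~~ good t) pattern_prob t).
Proof.
move=> L0 VV encE hgood.
apply: le_trans (@choi_error_recovery R L _ _ _ enc _
  (fun t : {ffun Q -> option bool} => \prod_q erase_weight1 (t q))
  (@pattern_size_weight Q) (fun t => erase_kraus t *m V) good L0 _ _ _ _) _.
- by move=> t; apply: prodr_ge0 => q _; case: (t q) => [_|] /=; move: p01; lra.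
- by move=> t; apply: prodr_gt0 => q _; case: (t q) => [_|]; rewrite ?invr_gt0.
- move=> rho; rewrite encE tensor_power_erasure; apply: eq_bigr => t _.
  by rewrite adjM !mulmxA.
- by move=> t t' gt; apply: erase_kraus_ortho => //; exact: hgood.
apply: ler_wsqrtr; rewrite lerBlDr -[X in X <= _](pattern_prob_sum Q) (bigID good) /= addrC lerD2l.
by rewrite le_eqVlt; apply/orP; left; apply/eqP; apply: eq_bigr => t _; rewrite pattern_probE.
Qed.
End Erasure.

(** * The encoder *)

Section Circuit.
Local Open Scope sesquilinear_scope.
Local Open Scope complex_scope.
Variable R : realType.
Local Notation C := R[i].
Local Notation labmx := (labmx R).
Variables (N kappa alpha : nat).
Local Notation qubit := ('I_N.*2 * region kappa alpha)%type.
Local Notation phys := (physical N kappa alpha).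
Local Notation logi := (logical N kappa).

Definition ancilla0 (x : phys) := [forall r, forall a, ~~ x (r, inr a)].
Definition logical_part (x : phys) : logi := [ffun q => x (q.1, inl q.2)].

Definition anc_op : 'M[C]_(#|phys|, #|logi|) :=
  rop (fun (x : phys) (l : logi) => (ancilla0 x && (logical_part x == l))%:R).

Lemma add_ancillasE (rho : opr R logi) : add_ancillas alpha rho = anc_op *m rho *m anc_op ^t*.
Proof.
apply: ent_inj => x y; rewrite ent_rop -/(ancilla0 x) -/(ancilla0 y).
rewrite -/(logical_part x) -/(logical_part y) ent_mul (bigD1 (logical_part y)) //=.
rewrite [X in _ + X]big1 => [|l /negPf ly]; last first.
  by rewrite ent_adj ent_rop eq_sym ly andbF rmorph0 mulr0.
rewrite addr0 ent_mul (bigD1 (logical_part x)) //= [X in _ + X]big1 => [|l /negPf lx]; last first.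
  by rewrite ent_rop eq_sym lx andbF mul0r.
rewrite ent_adj !ent_rop !eqxx !andbT addr0 rmorph_nat.
by case: (ancilla0 x); case: (ancilla0 y); rewrite /= ?mul1r ?mulr1 ?mulr0 ?mul0r.
Qed.

Definition embed_logical (l : logi) : phys :=
  [ffun q => match q.2 with inl i => l (q.1, i) | inr _ => false end].

Lemma embed_logicalK l : logical_part (embed_logical l) = l.
Proof. by apply/ffunP => -[r i]; rewrite !ffunE. Qed.

Lemma ancilla0_embed l : ancilla0 (embed_logical l).
Proof. by apply/forallP => r; apply/forallP => i; rewrite ffunE. Qed.

Lemma ancilla0_eq x : ancilla0 x -> x = embed_logical (logical_part x).
Proof.
move=> /forallP h; apply/ffunP => -[r [i|i]]; rewrite ffunE /= ?[logical_part _ _]ffunE //.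
by have /forallP/(_ i)/negPf := h r.
Qed.

Lemma anc_op_iso : anc_op ^t* *m anc_op = 1%:M.
Proof.
apply: ent_inj => l l'; rewrite ent_mul ent_scalar (bigD1 (embed_logical l)) //=.
rewrite [X in _ + X]big1 => [|x xl]; last first.
  rewrite ent_adj ent_rop; case: andP => [[a0 /eqP lx]|_]; last by rewrite rmorph0 mul0r.
  by rewrite -lx -ancilla0_eq ?eqxx in xl.
by rewrite addr0 ent_adj !ent_rop ancilla0_embed embed_logicalK eqxx /= rmorph1 mul1r.
Qed.

Definition flips_ancilla (a : label qubit) :=
  [exists r : 'I_N.*2, exists i : 'I_alpha, (a (r, inr i)).1].

(** An X factor sends an ancilla from 0 to 1, hence out of the range of [anc_op]. *)
Lemma anc_op_flip (a : label qubit) : flips_ancilla a -> anc_op ^t* *m labmx a *m anc_op = 0.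
Proof.
move=> /existsP[r /existsP[i ari]]; apply: ent_inj => l l'; rewrite ent_mul.
rewrite big1 => [|y _]; first by rewrite /ent mxE.
rewrite ent_mul [ent anc_op _ _]ent_rop; case: (boolP (ancilla0 y)) => [hy|_]; last by rewrite mulr0.
rewrite big1 ?mul0r // => x _; rewrite ent_adj ent_rop.
case: (boolP (ancilla0 x)) => [hx|_]; last by rewrite rmorph0 mul0r.
rewrite [ent (labmx a) _ _]ent_rop (bigD1 (r, inr i)) //= /pauli1 ari.
have /forallP/(_ i)/negPf -> := forallP hx r.
by have /forallP/(_ i)/negPf -> := forallP hy r; rewrite /= !mul0r mulr0.
Qed.

Lemma adjacent_qubits_inj (j : 'I_N.*2.-1) : injective (@adjacent_qubits N kappa alpha j).
Proof.
move=> [b x] [b' x'] [/eqP]; rewrite eqn_add2l => /eqP e ->; congr (_, _).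
by case: b b' e => [] [].
Qed.

Variable G : gate_choice N kappa alpha.

Definition gate_seq (b : bool) : seq 'I_N.*2.-1 := [seq j : 'I_N.*2.-1 <- index_enum 'I_N.*2.-1 | odd j == b].

Definition layer_label (b : bool) : label qubit -> label qubit :=
  apply_gates (@adjacent_qubits N kappa alpha) G (gate_seq b).

Definition circuit_label (a : label qubit) := layer_label false (layer_label true a).

Lemma layer_label_conj b a : G \in ensemble R N kappa alpha ->
  conj_lab (layer R G b) a (layer_label b a).
Proof.
rewrite inE => /forallP hG; apply: layer_conj => //; exact: adjacent_qubits_inj.
Qed.

Lemma circuit_label_conj a : G \in ensemble R N kappa alpha ->
  conj_lab (circuit R G) a (circuit_label a).
Proof. by move=> hG; apply: conj_labM; apply: layer_label_conj. Qed.

Lemma circuit_iso : G \in ensemble R N kappa alpha ->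
  (circuit R G) ^t* *m circuit R G = 1%:M.
Proof.
rewrite inE => /forallP hG.
have h b : (layer R G b) ^t* *m layer R G b = 1%:M.
  by apply: layer_iso => //; exact: adjacent_qubits_inj.
by rewrite adjM mulmxA -(mulmxA (_ ^t*)) h mulmx1 h.
Qed.

(* Stabilizers supported on the erased qubits are harmless, but counting them as errors
   makes the erased qubits maximally mixed and the decoder explicit. *)
Definition unrecoverable (t : {ffun qubit -> option bool}) :=
  [exists a : label qubit, [&& a != label0 _,
    [forall q, (t q == None) ==> (a q == (false, false))] & ~~ flips_ancilla (circuit_label a)]].

Lemma choi_error_circuit (p : R) : 0 <= p <= 1 -> G \in ensemble R N kappa alpha ->
  choi_error (encoder (circuit R G)) (tensor_power (erasure p)
       : opr R (physical N kappa alpha) -> opr R (received N kappa alpha)) <=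
  Num.sqrt (\sum_(t | unrecoverable t) pattern_prob p t).
Proof.
move=> p01 hG; set U := circuit R G.
apply: le_trans (@choi_error_erasure R p p01 _ _ (U *m anc_op) (encoder U)
   (fun t => ~~ unrecoverable t) _ _ _ _) _.
- by rewrite card_ffun card_bool expn_gt0.
- by rewrite adjM mulmxA -(mulmxA (_ ^t*)) circuit_iso // mulmx1 anc_op_iso.
- by move=> rho; rewrite /encoder add_ancillasE (adjM U) !mulmxA.
- move=> t; rewrite negb_exists => /forallP ht a a0 ha.
  have := ht a; rewrite a0 /= negb_and negbK => /orP[/negP[]|fl].
    by apply/forallP => q; apply/implyP => /eqP/ha ->.
  have [c hc] := circuit_label_conj a hG.
  transitivity (anc_op ^t* *m (U ^t* *m labmx a *m U) *m anc_op).
    by rewrite (adjM U) !mulmxA.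
  by rewrite hc -scalemxAr -scalemxAl anc_op_flip // scaler0.
- by apply: ler_wsqrtr; rewrite le_eqVlt; apply/orP; left; apply/eqP; apply: eq_bigl => t; rewrite negbK.
Qed.
End Circuit.

(** * Independent gates *)

Section ProductAverage.
Variables (R : realType) (J S : finType) (A : {set S}).
Hypothesis A_gt0 : (0 < #|A|)%N.
Implicit Types (f g : {ffun J -> S} -> R) (h : S -> R).

Definition mean h : R := (\sum_(s in A) h s) / #|A|%:R.

(** For the Clifford classes this is [ensemble], up to conversion, so that
    [expected_choi_error_blocks] is an instance of [avg]. *)
Definition choices : {set {ffun J -> S}} := finset (fun G : {ffun J -> S} => [forall j, G j \in A]).

Definition avg f : R := (\sum_(G in choices) f G) / #|choices|%:R.

Lemma in_choices G : (G \in choices) = (G \in ffun_on (mem A)).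
Proof. by rewrite inE; apply/forallP/ffun_onP. Qed.

Lemma card_choices : #|choices| = (#|A| ^ #|J|)%N.
Proof. by rewrite -(card_ffun_on J (mem A)); apply: eq_card => G; rewrite in_choices. Qed.

Lemma choices_gt0 : (0 < #|choices|)%N.
Proof. by rewrite card_choices expn_gt0 A_gt0. Qed.

Lemma avg_prod (F : J -> S -> R) : avg (fun G => \prod_j F j (G j)) = \prod_j mean (F j).
Proof.
rewrite /avg /mean big_split /= bigA_distr_big prodr_const card_choices natrX exprVn.
by congr (_ / _); apply: eq_bigl => G; exact: in_choices.
Qed.

Lemma avg_le f g : (forall G, G \in choices -> f G <= g G) -> avg f <= avg g.
Proof. by move=> h; rewrite ler_wpM2r ?invr_ge0 // ler_sum. Qed.

Lemma avg_cst (c : R) : avg (fun _ => c) = c.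
Proof. by rewrite /avg sumr_const -[c *+ _]mulr_natr mulfK // pnatr_eq0 -lt0n choices_gt0. Qed.

Lemma avg_sum (I : finType) (P : pred I) (f : I -> {ffun J -> S} -> R) :
  avg (fun G => \sum_(i | P i) f i G) = \sum_(i | P i) avg (f i).
Proof. by rewrite /avg exchange_big mulr_suml. Qed.

Lemma avgZ c f : avg (fun G => c * f G) = c * avg f.
Proof. by rewrite /avg -mulr_sumr mulrA. Qed.

Definition mix (b : pred J) (G G' : {ffun J -> S}) : {ffun J -> S} :=
  [ffun j => if b j then G j else G' j].

Lemma mixK b G G' : mix b (mix b G G') (mix b G' G) = G.
Proof. by apply/ffunP => j; rewrite !ffunE; case: (b j). Qed.

Lemma mix_choices b G G' : G \in choices -> G' \in choices -> mix b G G' \in choices.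
Proof.
rewrite !inE => /forallP h /forallP h'; apply/forallP => j.
by rewrite ffunE; case: (b j).
Qed.

(* Independence of the gates selected by [b] from the others: swapping them between two
   independent samples preserves the joint law. *)
Lemma avg_mix (b : pred J) f : avg f = avg (fun G => avg (fun G' => f (mix b G G'))).
Proof.
have C0 : #|choices|%:R != 0 :> R by rewrite pnatr_eq0 -lt0n choices_gt0.
apply: (mulIf C0); rewrite /avg -mulr_suml !divfK //; apply: (mulIf C0); rewrite divfK //.
rewrite mulr_natr -sumrMnl; under eq_bigr do rewrite -sumr_const.
rewrite !pair_big /=.
pose sw (x : {ffun J -> S} * {ffun J -> S}) := (mix b x.1 x.2, mix b x.2 x.1).
have swK : involutive sw by move=> [G G']; rewrite /sw /= !mixK.
rewrite (reindex_inj (inv_inj swK)) /=; apply: eq_bigl => -[G G'] /=.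
apply/andP/andP => -[hG hG']; last by split; exact: mix_choices.
by split; [rewrite -(mixK b G G') | rewrite -(mixK b G' G)]; exact: mix_choices.
Qed.
End ProductAverage.

(** * Survival of a label through the two layers, region by region *)

Definition ancilla_decay (R : realType) (alpha : nat) : R := 2^-1 ^+ alpha.
(** Number of Pauli labels of one region; [ancilla_decay] is the fraction of them without X factor
    on the ancillas, two of the four values being allowed on each. *)
Definition region_dim (R : realType) (kappa alpha : nat) : R := 4 ^+ (kappa + alpha).

Section OutputLabel.
Variables (R : realType) (N kappa alpha : nat).
Hypothesis size_gt0 : (0 < kappa + alpha)%N.
Local Notation reg := (region kappa alpha).
Local Notation qubit := ('I_N.*2 * reg)%type.
Local Notation gate_qubit := (bool * reg)%type.
Local Notation Cl := (clifford_classes R gate_qubit).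
Local Notation adj := (@adjacent_qubits N kappa alpha).
Implicit Types (y : label gate_qubit) (a : label qubit) (u : label reg).

Local Notation beta := (ancilla_decay R alpha).
Local Notation dim := (region_dim R kappa alpha).

Lemma beta_gt0 : 0 < beta.
Proof. by rewrite exprn_gt0 // invr_gt0. Qed.

Lemma beta_le1 : beta <= 1.
Proof. by rewrite exprn_ile1 // ?invr_ge0 // invf_le1 // ler1n. Qed.

Lemma beta_dim : 1 <= beta * dim.
Proof.
rewrite /ancilla_decay /region_dim exprD mulrCA -exprMn (_ : 2^-1 * 4 = 2 :> R); last by field.
by rewrite mulr_ege1 // exprn_ege1 // ler1n.
Qed.

Lemma dim_gt1 : 1 < dim.
Proof. by rewrite exprn_egt1 ?ltr1n // -lt0n. Qed.

Lemma card_region : #|reg| = (kappa + alpha)%N.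
Proof. by rewrite card_sum !card_ord. Qed.

Lemma card_gate_qubit : #|{: gate_qubit}| = (kappa + alpha).*2.
Proof. by rewrite card_prod card_bool card_region mul2n. Qed.

Definition half y (c : bool) : label reg := [ffun x => y (c, x)].

Definition part a (r : 'I_N.*2) : label reg := [ffun x => a (r, x)].

Definition fixes_ancilla y := [forall c, forall i : 'I_alpha, ~~ (y (c, inr i)).1].

(** A price [z] per region with nonzero label; products over regions turn bounds on survival into
    quantities that factor. *)
Definition active_cost (z : R) u : R := if u == label0 reg then 1 else z.

Lemma sum_prod_half (f : label reg -> R) :
  \sum_y \prod_c f (half y c) = (\sum_u f u) ^+ 2.
Proof.
transitivity (\prod_(c : bool) \sum_u f u); last by rewrite big_bool expr2.
rewrite bigA_distr_bigA /=.
pose h (g : {ffun bool -> label reg}) : label gate_qubit := [ffun q => g q.1 q.2].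
pose h' y : {ffun bool -> label reg} := [ffun c => half y c].
have hK : cancel h h' by move=> g; apply/ffunP => c; rewrite ffunE; apply/ffunP => x; rewrite !ffunE.
have h'K : cancel h' h by move=> y; apply/ffunP => -[c x]; rewrite !ffunE.
rewrite (reindex h) /=; last by exists h' => ? _; [exact: hK | exact: h'K].
apply: eq_bigr => g _; apply: eq_bigr => c _; congr f.
by apply/ffunP => x; rewrite !ffunE.
Qed.

Lemma sum_active_cost z : \sum_u active_cost z u = 1 + (dim - 1) * z.
Proof.
rewrite (bigD1 (label0 reg)) //= /active_cost eqxx; congr (_ + _).
rewrite (eq_bigr (fun _ => z)) => [|u /negPf -> //].
rewrite (eq_bigl (mem (predC1 (label0 reg)))) // sumr_const.
have -> : #|mem (predC1 (label0 reg))| = (4 ^ (kappa + alpha)).-1.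
  by have := cardC1 (label0 reg); rewrite /= card_label card_region.
by rewrite -[LHS]mulr_natl -subn1 natrB ?expn_gt0 // natrX.
Qed.

Lemma half0 c : half (label0 gate_qubit) c = label0 reg.
Proof. by apply/ffunP => x; rewrite !ffunE. Qed.

Lemma half_neq0 y : y != label0 gate_qubit -> exists c, half y c != label0 reg.
Proof.
move=> y0; apply/existsP; rewrite -negb_forall; apply: contra y0 => /forallP h.
apply/eqP/ffunP => -[c x]; have /eqP/ffunP/(_ x) := h c.
by rewrite !ffunE.
Qed.

Lemma mean_lab_act y (f : label gate_qubit -> R) : y != label0 _ ->
  (dim ^+ 2 - 1) * mean Cl (fun s => f (lab_act (s^-1)%g y)) =
  \sum_(x | x != label0 _) f x.
Proof.
move=> y0; have := avg_lab_act f y0; rewrite card_gate_qubit -mul2n mulnC exprM -/(region_dim R kappa alpha) => h.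
rewrite /mean mulrA h mulrC mulKf //.
by rewrite pnatr_eq0 -lt0n classes_gt0.
Qed.

Lemma sum_bool2 (F : bool * bool -> R) :
  \sum_v F v = F (true, true) + F (true, false) + (F (false, true) + F (false, false)).
Proof.
rewrite (eq_bigr (fun v => F (v.1, v.2))) => [|[]//].
by rewrite -(pair_bigA _ (fun b c : bool => F (b, c))) /= !big_bool.
Qed.

Lemma sum_fixes_ancilla : \sum_y (fixes_ancilla y)%:R = (beta * dim) ^+ 2.
Proof.
pose g (q : gate_qubit) (v : bool * bool) : R := if q.2 is inr _ then (~~ v.1)%:R else 1.
transitivity (\sum_(y : label gate_qubit) \prod_q g q (y q)).
  apply: eq_bigr => y _; case: (boolP (fixes_ancilla y)) => [/forallP h|].
    rewrite big1 // => -[c [i|i]] _ //.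
    by have /forallP/(_ i) := h c; rewrite /g /= => ->.
  rewrite negb_forall => /existsP[c]; rewrite negb_forall => /existsP[i hi].
  by rewrite (bigD1 (c, inr i)) //= /g /= (negPf hi) mul0r.
rewrite -(bigA_distr_bigA g).
rewrite (eq_bigr (fun q : gate_qubit => (fun (c : bool) (x : reg) => if x is inr _ then 2 else 4) q.1 q.2)).
  rewrite -(pair_bigA _ (fun (c : bool) (x : reg) => if x is inr _ then 2 else 4)) /=.
  rewrite big_bool /= -expr2; congr (_ ^+ 2).
  rewrite big_sumType /= !prodr_const !card_ord /ancilla_decay /region_dim exprD mulrCA -exprMn.
  by rewrite (_ : 2^-1 * 4 = 2 :> R) //; field.
by move=> [c [i|i]] _; rewrite [LHS]sum_bool2 /g /=; ring.
Qed.

(** For nonzero [y] the mean is [((beta * dim)^2 - 1) / (dim^2 - 1)], at most [beta^2] as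
    [beta <= 1]. At most two halves are active, so the product of costs is at least [beta^2]. *)
Lemma mean_fixes_ancilla y :
  mean Cl (fun s => (fixes_ancilla (lab_act (s^-1)%g y))%:R) <=
  \prod_c active_cost beta (half y c).
Proof.
have b0 := beta_gt0; have b1 := beta_le1; have d1 := dim_gt1.
case: (eqVneq y (label0 _)) => [->|y0].
  rewrite big1 => [|c _]; last by rewrite /active_cost half0 eqxx.
  rewrite ler_pdivrMr ?ltr0n ?classes_gt0 // mul1r -sumr_const ler_sum // => s _.
  by rewrite lern1 leq_b1.
apply: (@le_trans _ _ (beta ^+ 2)).
  have := mean_lab_act (fun x => (fixes_ancilla x)%:R) y0.
  set m := mean _ _ => hm.
  have := sum_fixes_ancilla; rewrite (bigD1 (label0 _)) //= -hm.
  have -> : fixes_ancilla (label0 _) by apply/forallP => c; apply/forallP => i; rewrite ffunE.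
  move=> e; have : (dim ^+ 2 - 1) * (beta ^+ 2 - m) >= 0.
    rewrite mulrBr -[X in _ - X](addKr 1) e; nra.
  by rewrite pmulr_rge0 ?subr_ge0 //; nra.
have [c hc] := half_neq0 y0.
rewrite (bigD1 c) //= expr2 /active_cost (negPf hc).
apply: ler_wpM2l; first exact: ltW.
rewrite (big_pred1 (~~ c)); last by case: c {hc} => -[].
by case: ifP.
Qed.

(* Constant 3: the outputs with a single active region add [2 beta / dim <= 2 beta ^ 2] to
   the [beta ^ 2] of the outputs with two active ones. *)
Lemma mean_active_cost y :
  mean Cl (fun s => \prod_c active_cost beta (half (lab_act (s^-1)%g y) c)) <=
  \prod_c active_cost (3 * beta) (half y c).
Proof.
have b0 := beta_gt0; have b1 := beta_le1; have d1 := dim_gt1; have bd := beta_dim.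
case: (eqVneq y (label0 _)) => [->|y0].
  rewrite [leRHS]big1 => [|c _]; last by rewrite /active_cost half0 eqxx.
  rewrite ler_pdivrMr ?ltr0n ?classes_gt0 // mul1r -sumr_const ler_sum // => s _.
  rewrite big_bool /= /active_cost; case: ifP; case: ifP => _ _; nra.
apply: (@le_trans _ _ (3 * beta ^+ 2)).
  have := mean_lab_act (fun x => \prod_c active_cost beta (half x c)) y0.
  set m := mean _ _ => hm.
  have := sum_prod_half (active_cost beta); rewrite (bigD1 (label0 _)) //= -hm.
  rewrite big1 => [|c _]; last by rewrite /active_cost half0 eqxx.
  rewrite sum_active_cost => e.
  (* By [e], the mean [m] is [((1 + (dim - 1) * beta)^2 - 1) / (dim^2 - 1)]. Clearing the
     denominator leaves an expression with the factor [dim * beta - 1], nonnegative by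
     [beta_dim]. *)
  have : (dim - 1) * ((dim + 1) * (3 * beta ^+ 2 - m)) >= 0.
    rewrite (_ : _ * _ = (dim ^+ 2 - 1) * (3 * beta ^+ 2) - (1 + (dim - 1) * beta) ^+ 2 + 1).
      rewrite (_ : _ + 1 = (dim - 1) * beta * (2 * (dim * beta - 1) + 4 * beta)); last by ring.
      by apply: mulr_ge0; [apply: mulr_ge0; lra | move: bd; rewrite mulrC; lra].
    by rewrite -e; ring.
  rewrite pmulr_rge0 ?subr_gt0 // pmulr_rge0 ?subr_ge0 //; lra.
have [c hc] := half_neq0 y0.
rewrite (bigD1 c) //= /active_cost (negPf hc).
rewrite (big_pred1 (~~ c)); last by case: c {hc} => -[].
by case: ifP => _; nra.
Qed.

Definition covered (b : bool) : {set 'I_N.*2} :=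
  [set adjacent_region jc.1 jc.2 | jc in [set jc : 'I_N.*2.-1 * bool | odd jc.1 == b]]%SET.

(** Within a layer the parity of [j] is fixed, so the parity of the region determines [c], and then
    [j]: the gates of a layer are disjoint. *)
Lemma adjacent_region_inj (b : bool) :
  {in [set jc : 'I_N.*2.-1 * bool | odd jc.1 == b]%SET &,
    injective (fun jc => adjacent_region jc.1 jc.2)}.
Proof.
move=> [j c] [j' c']; rewrite !inE /= => /eqP jb /eqP jb' [] e.
have : odd (j + c) = odd (j' + c') by rewrite e.
rewrite !oddD jb jb' => /addbI; rewrite !oddb => cc; subst c'.
by congr (_, _); apply/val_inj/(@addIn c).
Qed.

Lemma prod_layer (b : bool) (f : 'I_N.*2 -> R) :
  \prod_(j < N.*2.-1 | odd j == b) \prod_c f (adjacent_region j c) = \prod_(r in covered b) f r.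
Proof.
rewrite big_imset /=; last exact: adjacent_region_inj.
rewrite (pair_big (fun j : 'I_N.*2.-1 => odd j == b) predT
  (fun (j : 'I_N.*2.-1) (c : bool) => f (adjacent_region j c))) /=.
by apply: eq_bigl => -[j c]; rewrite inE andbT.
Qed.

Lemma covered_false : covered false = [set: 'I_N.*2]%SET.
Proof.
apply/finset.setP => r; rewrite inE; apply/imsetP; have ltr := ltn_ord r.
case: (boolP (odd r)) => [ro|re].
  have r0 : (0 < r)%N by case: (r : nat) ro.
  have lt : (r.-1 < N.*2.-1)%N by lia.
  exists (Ordinal lt, true); last by apply/val_inj; rewrite /= addn1 prednK.
  by rewrite inE /=; move: ro; rewrite -{1}(prednK r0) /= => /negPf ->.
have lt : (r < N.*2.-1)%N by move: re ltr; lia.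
exists (Ordinal lt, false); last by apply/val_inj; rewrite /= addn0.
by rewrite inE /= (negPf re).
Qed.

Lemma half_restr j a c : half (restr (adj j) a) c = part a (adjacent_region j c).
Proof. by apply/ffunP => x; rewrite !ffunE. Qed.

Section Gates.
Variable G : gate_choice N kappa alpha.

Lemma layer_label_in (j : 'I_N.*2.-1) a :
  restr (adj j) (layer_label G (odd j) a) = lab_act (G j)^-1%g (restr (adj j) a).
Proof.
apply/ffunP => q; rewrite ffunE /layer_label apply_gates_in //.
- exact: adjacent_qubits_inj.
- by rewrite filter_uniq // index_enum_uniq.
- by rewrite mem_filter eqxx mem_index_enum.
move=> j1 j2; rewrite !mem_filter => /andP[/eqP o1 _] /andP[/eqP o2 _] [c x] [c' x'] [] e _.
have := @adjacent_region_inj (odd j) (j1, c) (j2, c'); rewrite !inE /= o1 o2 => /(_ (eqxx _) (eqxx _)).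
move=> h; have /h [-> _] // : adjacent_region j1 c = adjacent_region j2 c'.
exact/val_inj.
Qed.

Lemma layer_label_out b a r : r \notin covered b -> part (layer_label G b a) r = part a r.
Proof.
move=> h; apply/ffunP => x; rewrite !ffunE apply_gates_out // => j [c y].
rewrite mem_filter => /andP[jb _]; apply: contra h => /eqP[hr _].
by apply/imsetP; exists (j, c); rewrite ?inE // -hr.
Qed.
End Gates.

Lemma layer_label_ext (G G' : gate_choice N kappa alpha) b a :
  (forall j : 'I_N.*2.-1, odd j = b -> G j = G' j) -> layer_label G b a = layer_label G' b a.
Proof.
move=> h; rewrite /layer_label.
have : all (fun j : 'I_N.*2.-1 => odd j == b) (gate_seq N b) by exact: filter_all.
elim: (gate_seq N b) a => //= j js IH a /andP[/eqP jb hjs].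
by rewrite IH // h.
Qed.

Lemma mean1 : mean Cl (fun _ => 1 : R) = 1.
Proof. by rewrite /mean sumr_const divff // pnatr_eq0 -lt0n classes_gt0. Qed.

Lemma avg_gates (b : bool) (F : 'I_N.*2.-1 -> {perm pauli gate_qubit} -> R) :
  avg Cl (fun G => \prod_(j < N.*2.-1 | odd j == b) F j (G j)) =
  \prod_(j < N.*2.-1 | odd j == b) mean Cl (F j).
Proof.
have := avg_prod Cl (fun (j : 'I_N.*2.-1) s => if odd j == b then F j s else 1).
rewrite (eq_bigr (fun j : 'I_N.*2.-1 => if odd j == b then mean Cl (F j) else 1)) => [|j _]; last first.
  by case: ifP => // _; rewrite mean1.
rewrite -big_mkcond => <-; congr (avg Cl); apply/funext => G.
by rewrite big_mkcond.
Qed.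

(** The even layer touches every region, so absence of X factors on all ancillas is implied by, and
    here bounded through, separate conditions on its independent gates. *)
Lemma avg_fixes_layer a :
  avg Cl (fun G => (~~ flips_ancilla (layer_label G false a))%:R) <=
  \prod_r active_cost beta (part a r).
Proof.
apply: (@le_trans _ _ (avg Cl (fun G => \prod_(j < N.*2.-1 | odd j == false)
   (fixes_ancilla (lab_act (G j)^-1%g (restr (adj j) a)))%:R))).
  apply: avg_le => G _; case: (boolP (flips_ancilla _)) => [_|h] /=.
    by apply: prodr_ge0 => j _; rewrite ler0n.
  rewrite big1 // => j /eqP oj; rewrite -layer_label_in oj.
  apply/eqP; rewrite pnatr_eq1 eqb1; apply/forallP => c; apply/forallP => i.
  rewrite ffunE; apply: contra h => h; apply/existsP; exists (adjacent_region j c).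
  by apply/existsP; exists i.
rewrite (avg_gates false (fun j s => (fixes_ancilla (lab_act s^-1%g (restr (adj j) a)))%:R)).
rewrite (eq_bigl (mem (covered false))) => [|r]; last by rewrite covered_false !inE.
rewrite -prod_layer; apply: ler_prod => j _; apply/andP; split.
  by rewrite divr_ge0 ?ler0n // sumr_ge0 // => s _; rewrite ler0n.
apply: le_trans (mean_fixes_ancilla _) _; rewrite le_eqVlt; apply/orP; left; apply/eqP.
by apply: eq_bigr => c _; rewrite half_restr.
Qed.

Lemma active_cost_ge0 z u : 0 <= z -> 0 <= active_cost z u.
Proof. by rewrite /active_cost; case: ifP. Qed.

(* An active even gate costs [beta ^ 2], which is at most the product of the costs of its
   two regions; in this form the bound factors over the odd gates. *)
Lemma avg_fixes_circuit a :
  avg Cl (fun G => (~~ flips_ancilla (circuit_label G a))%:R) <=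
  \prod_r active_cost (3 * beta) (part a r).
Proof.
have b0 := beta_gt0.
(* In the mixture the odd layer, which the label meets first, depends on [G] only, and the even
   layer on [G'] only; so [avg_fixes_layer] applies with [G] frozen. *)
rewrite (avg_mix (classes_gt0 _ _) (fun j : 'I_N.*2.-1 => odd j)).
apply: (@le_trans _ _ (avg Cl (fun G => \prod_r active_cost beta (part (layer_label G true a) r)))).
  apply: avg_le => G _; apply: le_trans (avg_fixes_layer _).
  apply: avg_le => G' _; rewrite /circuit_label.
  rewrite (@layer_label_ext (mix _ G G') G true) => [|j oj]; last by rewrite ffunE oj.
  by rewrite (@layer_label_ext (mix _ G G') G' false) => // j oj; rewrite ffunE oj.
(* The odd layer misses the two end regions, whose labels it leaves unchanged; their cost [beta] is
   finally weakened to [3 * beta]. *)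
pose K := \prod_(r | r \notin covered true) active_cost beta (part a r).
have K0 : 0 <= K by apply: prodr_ge0 => r _; apply: active_cost_ge0; exact: ltW.
rewrite (_ : (fun G => _) = fun G : {ffun 'I_N.*2.-1 -> {perm pauli gate_qubit}} =>
    K * \prod_(j < N.*2.-1 | odd j == true)
    \prod_c active_cost beta (half (lab_act (G j)^-1%g (restr (adj j) a)) c)).
  rewrite avgZ (avg_gates true (fun j s =>
    \prod_c active_cost beta (half (lab_act s^-1%g (restr (adj j) a)) c))).
  rewrite [leRHS](bigID (mem (covered true))) /= mulrC; apply: ler_pM => //.
  - apply: prodr_ge0 => j _; rewrite divr_ge0 ?ler0n // sumr_ge0 // => s _.
    by apply: prodr_ge0 => c _; apply: active_cost_ge0; exact: ltW.
  - rewrite -prod_layer; apply: ler_prod => j _; apply/andP; split.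
      rewrite divr_ge0 ?ler0n // sumr_ge0 // => s _.
      by apply: prodr_ge0 => c _; apply: active_cost_ge0; exact: ltW.
    apply: le_trans (mean_active_cost _) _; rewrite le_eqVlt; apply/orP; left; apply/eqP.
    by apply: eq_bigr => c _; rewrite half_restr.
  - apply: ler_prod => r _; apply/andP; split; first by apply: active_cost_ge0; exact: ltW.
    by rewrite /active_cost; case: ifP => // _; lra.
apply/funext => G; rewrite (bigID (mem (covered true))) /= mulrC; congr (_ * _).
  by apply: eq_bigr => r hr; rewrite layer_label_out.
rewrite -prod_layer; apply: eq_bigr => j /eqP oj; apply: eq_bigr => c _.
by rewrite -half_restr -oj layer_label_in.
Qed.
End OutputLabel.

(** * Union bound over erased labels *)

Section UnionBound.
Variables (R : realType) (N kappa alpha : nat).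
Hypothesis size_gt0 : (0 < kappa + alpha)%N.
Local Notation reg := (region kappa alpha).
Local Notation qubit := ('I_N.*2 * reg)%type.
Local Notation Cl := (clifford_classes R (bool * reg)%type).
Local Notation beta := (ancilla_decay R alpha).
Local Notation pattern := {ffun qubit -> option bool}.

Lemma sum_part (P : 'I_N.*2 -> pred (label reg)) (f : label reg -> R) :
  \sum_(a : label qubit | [forall r, P r (part a r)]) \prod_r f (part a r) =
  \prod_r \sum_(u | P r u) f u.
Proof.
rewrite bigA_distr_big_dep /=.
pose h (g : {ffun 'I_N.*2 -> label reg}) : label qubit := [ffun q => g q.1 q.2].
pose h' (a : label qubit) : {ffun 'I_N.*2 -> label reg} := [ffun r => part a r].
have hK : cancel h h' by move=> g; apply/ffunP => c; rewrite ffunE; apply/ffunP => x; rewrite !ffunE.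
have h'K : cancel h' h by move=> y; apply/ffunP => -[c x]; rewrite !ffunE.
have ph g r : part (h g) r = g r by apply/ffunP => x; rewrite !ffunE.
rewrite (reindex h) /=; last by exists h' => ? _; [exact: hK | exact: h'K].
apply: eq_big => [g|g _]; last by apply: eq_bigr => r _; rewrite ph.
by apply/forallP/familyP => H r; have := H r; rewrite ph.
Qed.

Definition erased_labels (t : pattern) r : R :=
  \prod_(x : reg) (if t (r, x) is Some _ then 4 else 1).

Definition erased_supp (t : pattern) r (u : label reg) :=
  [forall x, (t (r, x) == None) ==> (u x == (false, false))].

Lemma erased_labels_sum t r : \sum_(u | erased_supp t r u) 1 = erased_labels t r.
Proof.
rewrite /erased_labels.
rewrite (eq_bigr (fun x => \sum_(v : bool * bool | (t (r, x) == None) ==> (v == (false, false))) 1)).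
  rewrite bigA_distr_big_dep /=; apply: eq_big => [u|u _]; last by rewrite big1.
  by apply/forallP/familyP => H x; have := H x.
move=> x _; case: (t (r, x)) => [b|] /=; last by rewrite big_pred1_eq.
by rewrite sum_bool2; ring.
Qed.

Lemma sum_erased_cost t r : \sum_(u | erased_supp t r u) active_cost (3 * beta) u <=
  1 + 3 * beta * erased_labels t r.
Proof.
have b0 : 0 < beta by exact: beta_gt0.
rewrite -erased_labels_sum mulr_sumr.
have s0 : erased_supp t r (label0 reg).
  by apply/forallP => x; apply/implyP => _; rewrite ffunE.
rewrite (bigD1 (label0 reg)) //= /active_cost eqxx lerD2l [leRHS](bigD1 (label0 reg)) //= mulr1.
rewrite -[leLHS]add0r; apply: lerD; first by apply: mulr_ge0 => //; exact: ltW.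
by apply: ler_sum => u /andP[_ /negPf ->].
Qed.

(** Union bound over the nonzero labels supported on the erased qubits. With the zero label included
    the sum of product bounds factors over the regions; that label contributes the 1 which is
    subtracted. *)
Lemma avg_unrecoverable (t : pattern) :
  avg Cl (fun G => (unrecoverable G t)%:R) <=
  \prod_r (1 + 3 * beta * erased_labels t r) - 1.
Proof.
pose supp (a : label qubit) := [forall r, erased_supp t r (part a r)].
have supp0 : supp (label0 qubit).
  by apply/forallP => r; apply/forallP => x; apply/implyP => _; rewrite !ffunE.
have part0 r : part (label0 qubit) r = label0 reg by apply/ffunP => x; rewrite !ffunE.
apply: (@le_trans _ _ (\sum_(a | supp a && (a != label0 qubit))
    avg Cl (fun G => (~~ flips_ancilla (circuit_label G a))%:R))).
  rewrite -avg_sum; apply: avg_le => G _.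
  case: (boolP (unrecoverable G t)) => [/existsP[a /and3P[a0 ha fl]]|_]; last first.
    by apply: sumr_ge0 => a _; rewrite ler0n.
  rewrite (bigD1 a) /=; last first.
    rewrite a0 andbT; apply/forallP => r; apply/forallP => x.
    by have /forallP/(_ (r, x)) := ha; rewrite ffunE.
  by rewrite fl lerDl; apply: sumr_ge0 => a' _; rewrite ler0n.
apply: (@le_trans _ _ (\sum_(a | supp a && (a != label0 qubit))
    \prod_r active_cost (3 * beta) (part a r))).
  by apply: ler_sum => a _; exact: avg_fixes_circuit.
have := sum_part (erased_supp t) (active_cost (3 * beta)); rewrite (bigD1 (label0 qubit)) //=.
rewrite [X in X + _]big1 => [|r _]; last by rewrite part0 /active_cost eqxx.
move=> e; rewrite lerBrDl e; apply: ler_prod => r _.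
rewrite sum_erased_cost andbT; apply: sumr_ge0 => u _; apply: active_cost_ge0.
by apply: mulr_ge0 => //; exact/ltW/beta_gt0.
Qed.
End UnionBound.

(** * Averaging over erasure patterns *)

Section Analysis.
Variable R : realType.

(** Moves the cap from the product to the factors. If the right side is below 1, no factor is capped
    and [sum y < 1/2]; in that range [prod (1 + y) <= 1 + 2 sum y] follows by induction. *)
Lemma prod1D_bound (I : finType) (y : I -> R) : (forall i, 0 <= y i) ->
  Num.min 1 (\prod_i (1 + y i) - 1) <= 2 * \sum_i Num.min 1 (y i).
Proof.
move=> y0; have m0 i : 0 <= Num.min 1 (y i) by rewrite le_min ler01 y0.
case: (lerP 1 (2 * \sum_i Num.min 1 (y i))) => [h|h].
  by apply: le_trans h; rewrite ge_min lexx.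
rewrite ge_min; apply/orP; right.
have small i : Num.min 1 (y i) = y i.
  apply/min_idPr; rewrite leNgt; apply/negP => yi; move: h.
  rewrite (bigD1 i) //= (min_idPl (ltW yi)).
  have : 0 <= \sum_(j | j != i) Num.min 1 (y j) by apply: sumr_ge0.
  lra.
have e : \sum_i Num.min 1 (y i) = \sum_i y i by apply: eq_bigr.
rewrite e in h *; rewrite lerBlDl.
suff [] : \prod_i (1 + y i) <= 1 + 2 * \sum_i y i /\ 0 <= \sum_i y i by [].
move: h; elim: (index_enum I) => [|i s IH].
  by rewrite !big_nil mulr0 addr0.
rewrite !big_cons => h; have yi := y0 i.
have S0 : 0 <= \sum_(j <- s) y j by apply: sumr_ge0.
have [|IH1 _] := IH; first by lra.
by split; [nra | lra].
Qed.

(** Tangent line to the square root at [l^2], by expanding [(sqrt x - l)^2 >= 0]. Being affine in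
    [x], it commutes with averages. *)
Lemma sqrt_le_tangent (x l : R) : 0 < l -> 0 <= x -> Num.sqrt x <= (x / l + l) / 2.
Proof.
move=> l0 x0; have s0 := sqrtr_ge0 x.
rewrite ler_pdivlMr // -(ler_pM2r l0) mulrDl divfK ?gt_eqF //.
by have := sqr_ge0 (Num.sqrt x - l); have := sqr_sqrtr x0; rewrite !expr2; nra.
Qed.

(** From [exp u <= 1 / (1 - u)] and [(1 - u) (1 + u + 2 u^2) = 1 + u^2 (1 - 2u)]. *)
Lemma expR_le_quad (u : R) : 0 <= u <= 2^-1 -> expR u - 1 <= u + 2 * u ^+ 2.
Proof.
move=> /andP[u0 u1]; have := expR_ge1Dx (- u); rewrite expRN => h.
have e0 := expR_gt0 u.
have h1 : expR u * (1 - u) <= expR u * (expR u)^-1 by rewrite ler_wpM2l // ltW.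
rewrite mulfV ?gt_eqF // in h1.
have u2 : 0 <= u ^+ 2 * (1 - 2 * u) by rewrite mulr_ge0 ?sqr_ge0 //; lra.
have u3 : 0 < 1 - u by lra.
rewrite -(ler_pM2r u3); nra.
Qed.

(** The Chernoff step [min(1, 3x) <= 3 x^tau] for [x = exp z]: the cap wins for [x >= 1], and
    [x <= x^tau] below. *)
Lemma min1_expR (z tau : R) : 0 <= tau <= 1 -> Num.min 1 (3 * expR z) <= 3 * expR (tau * z).
Proof.
move=> /andP[t0 t1]; case: (lerP 0 z) => z0.
  apply: le_trans (_ : 1 <= _); first by rewrite ge_min lexx.
  by have := expR_ge1Dx (tau * z); have := mulr_ge0 t0 z0; lra.
rewrite ge_min ler_pM2l // ler_expR; apply/orP; right; nra.
Qed.
End Analysis.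

Section Expectation.
Variables (R : realType) (N kappa alpha : nat) (p : R).
Hypothesis size_gt0 : (0 < kappa + alpha)%N.
Hypothesis p01 : 0 <= p <= 1.
Local Notation reg := (region kappa alpha).
Local Notation qubit := ('I_N.*2 * reg)%type.
Local Notation Cl := (clifford_classes R (bool * reg)%type).
Local Notation beta := (ancilla_decay R alpha).
Local Notation pattern := {ffun qubit -> option bool}.

Lemma prod_fiber (r : 'I_N.*2) (h : qubit -> R) :
  \prod_(x : reg) h (r, x) = \prod_q (if q.1 == r then h q else 1).
Proof.
rewrite (eq_bigr (fun q : qubit => (fun r' (x : reg) => if r' == r then h (r', x) else 1) q.1 q.2)); last first.
  by move=> [r' x].
rewrite -(pair_bigA _ (fun r' (x : reg) => if r' == r then h (r', x) else 1)) /=.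
rewrite (bigD1 r) //= [X in _ = _ * X]big1 => [|r' /negPf r'r]; last by rewrite r'r big1.
by rewrite eqxx mulr1.
Qed.

(** Generating function of the number of erased qubits in one region, a binomial variable; all other
    regions sum to 1. *)
Lemma pattern_prob_region (r : 'I_N.*2) (b : R) :
  \sum_(t : pattern) pattern_prob p t * \prod_(x : reg) (if t (r, x) is Some _ then b else 1) =
  (1 + p * (b - 1)) ^+ (kappa + alpha).
Proof.
pose w (k : option bool) : R := if k is Some _ then p / 2 else 1 - p.
pose g (k : option bool) : R := if k is Some _ then b else 1.
transitivity (\sum_(t : pattern) \prod_q (w (t q) * (if q.1 == r then g (t q) else 1))).
  by apply: eq_bigr => t _; rewrite big_split /= -(prod_fiber r (fun q => g (t q))).
rewrite -(bigA_distr_bigA (fun (q : qubit) k => w k * (if q.1 == r then g k else 1))) /=.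
transitivity (\prod_(q : qubit) (if q.1 == r then 1 + p * (b - 1) else 1)).
  by apply: eq_bigr => q _; rewrite sum_option_bool /w /g; case: ifP => _; field.
by rewrite -(prod_fiber r (fun _ => 1 + p * (b - 1))) prodr_const card_region.
Qed.

(** Taking [z] as the logarithm makes the power [tau] a product over qubits, the form in which the
    generating function applies. *)
Lemma erased_labels_expR (t : pattern) r : exists z : R,
  beta * erased_labels R t r = expR z /\
  forall tau, expR (tau * z) = expR (tau * (- ln 2)) ^+ alpha *
    \prod_(x : reg) (if t (r, x) is Some _ then expR (tau * (2 * ln 2)) else 1).
Proof.
pose z := alpha%:R * (- ln 2) + \sum_(x : reg) (if t (r, x) is Some _ then 2 * ln 2 else 0) : R.
have h tau : expR (tau * z) = expR (tau * (- ln 2)) ^+ alpha *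
    \prod_(x : reg) (if t (r, x) is Some _ then expR (tau * (2 * ln 2)) else 1).
  rewrite mulrDr mulrCA expRD expRM_natl; congr (_ * _).
  rewrite mulr_sumr expR_sum; apply: eq_bigr => x _.
  by case: (t _) => [_|] //; rewrite mulr0 expR0.
exists z; split=> //; rewrite -[z]mul1r h !mul1r expRN lnK ?posrE //.
congr (_ * _); apply: eq_bigr => x _; case: (t _) => [_|] //.
by rewrite mulr_natl mulr2n expRD lnK ?posrE //; ring.
Qed.

Lemma mean_min_erased (u : R) r : 0 <= u <= 2 * ln 2 ->
  \sum_(t : pattern) pattern_prob p t * Num.min 1 (3 * beta * erased_labels R t r) <=
  3 * expR (- (alpha%:R * (u / 2)) + (kappa + alpha)%:R * (p * (expR u - 1))).
Proof.
move=> /andP[u0 u1]; have l2 : 0 < ln 2 :> R by rewrite ln_gt0 // ltr1n.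
(* Chosen so that [4^tau = exp u] and [2^-tau = exp (- u / 2)]. *)
pose tau := u / (2 * ln 2).
have tau01 : 0 <= tau <= 1.
  have l22 : 0 < 2 * ln 2 :> R by rewrite mulr_gt0.
  by rewrite (divr_ge0 u0 (ltW l22)) ler_pdivrMr // mul1r.
have tu : tau * (2 * ln 2) = u by rewrite /tau divfK // mulf_neq0 ?gt_eqF.
have tl : tau * (- ln 2) = - (u / 2) by rewrite -tu; field.
apply: (@le_trans _ _ (\sum_(t : pattern) 3 * expR (- (u / 2)) ^+ alpha * (pattern_prob p t *
   \prod_(x : reg) (if t (r, x) is Some _ then expR u else 1)))).
  apply: ler_sum => t _; rewrite [leRHS]mulrCA; apply: ler_wpM2l; first exact: pattern_prob_ge0.
  have [z [hz hzt]] := erased_labels_expR t r; rewrite -mulrA hz.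
  by apply: le_trans (min1_expR _ tau01) _; rewrite hzt tu tl mulrA.
rewrite -mulr_sumr pattern_prob_region -mulrA ler_pM2l // expRD -(mulrN alpha%:R) !expRM_natl.
rewrite ler_wpM2l ?exprn_ge0 ?expR_ge0 //.
have e1 : 1 <= expR u by rewrite -expR0 ler_expR.
apply: lerXn2r; rewrite ?nnegrE ?expR_ge0 ?expR_ge1Dx //.
by apply: addr_ge0 => //; apply: mulr_ge0; move: p01 e1; lra.
Qed.

Lemma expected_unrecoverable (u : R) : 0 <= u <= 2 * ln 2 ->
  \sum_(t : pattern) pattern_prob p t * avg Cl (fun G => (unrecoverable G t)%:R) <=
  12 * N%:R * expR (- (alpha%:R * (u / 2)) + (kappa + alpha)%:R * (p * (expR u - 1))).
Proof.
move=> hu; set E := expR _.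
have avg1 (t : pattern) : avg Cl (fun G => (unrecoverable G t)%:R) <= 1 :> R.
  rewrite -[leRHS](avg_cst (R := R) 'I_N.*2.-1 (classes_gt0 R (bool * reg)%type)).
  by apply: avg_le => G _; rewrite lern1 leq_b1.
have y0 (t : pattern) r : 0 <= 3 * beta * erased_labels R t r.
  apply: mulr_ge0; first by apply: mulr_ge0 => //; exact/ltW/beta_gt0.
  by apply: prodr_ge0 => x _; case: (t _).
apply: (@le_trans _ _ (\sum_(t : pattern) \sum_r
    2 * (pattern_prob p t * Num.min 1 (3 * beta * erased_labels R t r)))).
  apply: ler_sum => t _; rewrite -mulr_sumr -mulr_sumr [leRHS]mulrCA.
  apply: ler_wpM2l; first exact: pattern_prob_ge0.
  apply: le_trans (prod1D_bound (y0 t)).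
  by rewrite le_min avg1 avg_unrecoverable.
rewrite exchange_big /=.
(* The constant 12 is the 2 of [prod1D_bound], times the 3 of the cost, times 2 for the [2N]
   regions. *)
apply: (@le_trans _ _ (\sum_(r < N.*2) 2 * (3 * E))).
  by apply: ler_sum => r _; rewrite -mulr_sumr ler_pM2l //; exact: mean_min_erased.
by rewrite sumr_const card_ord -[leLHS]mulr_natl -mul2n natrM le_eqVlt; apply/orP; left; apply/eqP; ring.
Qed.

Lemma avg_affine (a b : R) (f : gate_choice N kappa alpha -> R) :
  avg Cl (fun G => a * f G + b) = a * avg Cl f + b.
Proof.
rewrite -avgZ -[in RHS](avg_cst 'I_N.*2.-1 (classes_gt0 R (bool * reg)%type) b).
by rewrite /avg -mulrDl -big_split.
Qed.

Lemma expected_choi_error_tangent (l u : R) : 0 < l -> 0 <= u <= 2 * ln 2 ->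
  expected_choi_error_blocks N kappa alpha p <=
  (12 * N%:R * expR (- (alpha%:R * (u / 2)) + (kappa + alpha)%:R * (p * (expR u - 1))) / l + l) / 2.
Proof.
move=> l0 hu.
pose f (G : gate_choice N kappa alpha) : R := \sum_(t | unrecoverable G t) pattern_prob p t.
apply: (@le_trans _ _ (avg Cl (fun G => (l^-1 / 2) * f G + l / 2))).
  apply: avg_le => G hG; apply: le_trans (choi_error_circuit p01 hG) _.
  apply: le_trans (sqrt_le_tangent l0 _) _.
    by apply: sumr_ge0 => t _; exact: pattern_prob_ge0.
  by rewrite le_eqVlt; apply/orP; left; apply/eqP; rewrite /f; field; rewrite gt_eqF.
set B := 12 * N%:R * _.
have hB : avg Cl f <= B.
  apply: le_trans (expected_unrecoverable hu).
  rewrite le_eqVlt; apply/orP; left; apply/eqP.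
  rewrite (eq_bigr _ (fun t _ => esym (avgZ _ _ _))) -avg_sum; congr (avg Cl).
  apply/funext => G; rewrite /f big_mkcond.
  by apply: eq_bigr => t _; case: ifP; rewrite ?mulr1 ?mulr0.
rewrite avg_affine; move: (avg Cl f) hB => x hB.
have : l^-1 * x <= l^-1 * B by rewrite ler_wpM2l // invr_ge0 ltW.
lra.
Qed.
End Expectation.

(** To first order in [u] the exponent is [u (p xi - alpha / 2)], at most [- u delta xi / 2] by the
    rate hypothesis. A small [u] keeps the quadratic remainder [2 p u^2 xi] within half of this
    gain. *)
Lemma expected_choi_error_blocks_le (R : realType) (p delta : R) : 0 <= p <= 1 -> 0 < delta ->
  exists2 c : R, 0 < c & forall N kappa alpha (l : R), (0 < kappa + alpha)%N -> 0 < l ->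
    (2 * p + delta) * (kappa + alpha)%:R <= alpha%:R ->
    expected_choi_error_blocks N kappa alpha p <=
      (12 * N%:R * expR (- (c * (kappa + alpha)%:R)) / l + l) / 2.
Proof.
move=> p01 d0; have l2 : 0 < ln 2 :> R by rewrite ln_gt0 // ltr1n.
(* The three bounds serve [tau <= 1], [expR_le_quad], and the absorption of the quadratic term,
   respectively. *)
pose u := Num.min (2 * ln 2) (Num.min 2^-1 (delta / 8)).
have u0 : 0 < u by rewrite /u !lt_min mulr_gt0 //= invr_gt0 ltr0n divr_gt0.
have u1 : u <= 2 * ln 2 by rewrite /u ge_min lexx.
have u2 : u <= 2^-1 by rewrite /u !ge_min lexx !orbT.
have u3 : u <= delta / 8 by rewrite /u !ge_min lexx !orbT.
exists (u * delta / 4); first by rewrite divr_gt0 // mulr_gt0.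
move=> N kappa alpha l sz l0 ha.
have hu : 0 <= u <= 2 * ln 2 by rewrite u1 ltW.
apply: le_trans (expected_choi_error_tangent N sz p01 l0 hu) _.
rewrite ler_pM2r ?invr_gt0 // lerD2r ler_pM2r ?invr_gt0 //.
rewrite ler_wpM2l ?mulr_ge0 // ler_expR.
have hu2 : 0 <= u <= 2^-1 by rewrite u2 ltW.
have := expR_le_quad hu2; set e := expR u - 1 => he.
move: p01 => /andP[p0 p1].
have x0 : 0 <= (kappa + alpha)%:R :> R by rewrite ler0n.
move: ha x0; move: (kappa + alpha)%:R => xi ha x0.
have h1 : (2 * p + delta) * xi * (u / 2) <= alpha%:R * (u / 2) by rewrite ler_wpM2r // divr_ge0 // ltW.
have h2 : xi * (p * e) <= xi * (p * (u + 2 * u ^+ 2)) by rewrite !ler_wpM2l.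
have h3 : p * u ^+ 2 <= u * delta / 8.
  apply: (@le_trans _ _ (1 * u ^+ 2)); first by rewrite ler_wpM2r ?sqr_ge0.
  by rewrite mul1r expr2 -mulrA ler_wpM2l // ltW.
have h4 : xi * (p * u ^+ 2) <= xi * (u * delta / 8) by rewrite ler_wpM2l.
lra.
Qed.

(** * The corollary *)

Local Open Scope classical_set_scope.
Local Open Scope ring_scope.
Lemma expected_choi_error_ge0 (R : realType) n k (eps p : R) : 0 <= expected_choi_error n k eps p.
Proof.
rewrite divr_ge0 ?ler0n //; apply: sumr_ge0 => G _; exact: choi_error_ge0.
Qed.

Lemma expected_choi_error_small (R : realType) (p delta eta : R) :
  0 <= p <= 1 -> 0 < delta -> 0 < eta ->
  exists2 c : R, 0 < c & forall (n k : nat) (eps : R), admissible n k eps ->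
    12 / eta ^+ 2 <= n%:R -> k%:R / n%:R <= 1 - 2 * p - delta ->
    c * log2 n%:R <= log2 (n%:R / eps) -> expected_choi_error n k eps p <= eta.
Proof.
move=> p01 d0 eta0; have [c c0 hc] := expected_choi_error_blocks_le p01 d0.
have l2 : 0 < ln 2 :> R by rewrite ln_gt0 // ltr1n.
(* With this constant [c * xi >= 2 ln n], so the exponential is at most [n^-2]: one factor [1 / n]
   absorbs the number of blocks, the other is compared with [eta^2 / 12]. *)
exists (2 * ln 2 / c); first by rewrite divr_gt0 // mulr_gt0.
move=> n k eps [[n0 kn] [eps0 xiE] dvN [dvk dva]] hn hk hlog.
rewrite /expected_choi_error; set xi := region_size n eps in xiE dvN dvk dva *.
set kappa := (k * xi %/ n)%N; set alpha := ((n - k) * xi %/ n)%N.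
have nR0 : 0 < n%:R :> R by rewrite ltr0n.
have xi0 : (0 < xi)%N.
  by rewrite lt0n; apply: contraTneq dvN => ->; rewrite muln0 dvd0n -lt0n.
have ka : (kappa + alpha)%N = xi.
  rewrite /kappa /alpha -divnDl // -mulnDl subnKC // mulKn //.
have ha : (2 * p + delta) * (kappa + alpha)%:R <= alpha%:R.
  have -> : alpha%:R = (1 - k%:R / n%:R) * xi%:R :> R.
    apply: (mulIf (lt0r_neq0 nR0)); rewrite -natrM divnK // natrM natrB //.
    by field; rewrite gt_eqF.
  by rewrite ka ler_wpM2r ?ler0n //; lra.
have sz : (0 < kappa + alpha)%N by rewrite ka.
(* Taking [l = eta], a bound [eta^2] on the failure term gives [(eta + eta) / 2 = eta]. *)
apply: le_trans (hc (n %/ (2 * xi))%N kappa alpha eta sz eta0 ha) _.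
suff hX : 12 * (n %/ (2 * xi))%:R * expR (- (c * (kappa + alpha)%:R)) <= eta ^+ 2.
  rewrite ler_pdivrMr // -lerBrDr ler_pdivrMr //.
  by apply: le_trans hX _; rewrite expr2 le_eqVlt; apply/orP; left; apply/eqP; ring.
have hexp : expR (- (c * (kappa + alpha)%:R)) <= n%:R^-1 * n%:R^-1.
  rewrite -(lnK (x := n%:R)) ?posrE // -expRN -expRD ler_expR ka xiE.
  move: hlog; rewrite /log2 -(ler_pM2l c0).
  have -> : c * (2 * ln 2 / c * (ln n%:R / ln 2)) = 2 * ln n%:R by field; rewrite !gt_eqF.
  rewrite -/(log2 _) => h; lra.
have hN : (n %/ (2 * xi))%:R <= n%:R :> R by rewrite ler_nat leq_div.
apply: (@le_trans _ _ (12 * n%:R * (n%:R^-1 * n%:R^-1))).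
  by apply: ler_pM; rewrite ?expR_ge0 ?ler_pM2l ?mulr_ge0 ?ler0n.
rewrite -mulrA mulVKf ?gt_eqF // ler_pdivrMr // mulrC -ler_pdivrMr ?exprn_gt0 //.
Qed.

Theorem corollary4 (R : realType) (p : R) (hp : 0 < p < 1) :
  (forall (delta : R) (k : nat -> nat) (eps : nat -> R),
    let A := [set n | admissible n (k n) (eps n)] in
    0 < delta ->
    (forall n, A n -> (k n)%:R / n%:R <= 1 - 2 * p - delta) ->
    log2 n%:R / log2 (n%:R / eps n) @[n --> within A \oo] --> (0 : R) ->
    \forall n \near within A \oo,
      let r : R := (k n)%:R / n%:R in
      expected_choi_error n (k n) (eps n) p <=
        Num.sqrt (8 * delta +
          Num.sqrt (2 `^ (- (n%:R * (1 - 2 * p - r - delta)))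
                    + 4 * eps n `^ (1 - r) * n%:R `^ r / log2 (n%:R / eps n))))
  /\
  (forall (rate : R) (k : nat -> nat) (eps : nat -> R),
    let A := [set n | admissible n (k n) (eps n)] in
    0 < rate < 1 - 2 * p ->
    (k n)%:R / n%:R @[n --> within A \oo] --> rate ->
    (forall c : R, \forall n \near within A \oo,
      c * log2 n%:R <= log2 (n%:R / eps n)) ->
    expected_choi_error n (k n) (eps n) p @[n --> within A \oo] --> (0 : R)).
Proof.
have p01 : 0 <= p <= 1 by case/andP: hp => p0 p1; rewrite !ltW.
have n_large (x : R) : \forall n \near \oo, x <= n%:R by exact: nbhs_infty_ger.
split=> [delta k eps A d0 hk hlog | rate k eps A /andP[r0 r1] hk hlog].
  have eta0 : 0 < Num.sqrt (8 * delta) by rewrite sqrtr_gt0 mulr_gt0.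
  have [c c0 hc] := expected_choi_error_small p01 d0 eta0.
  have : \forall n \near within A \oo, `|log2 n%:R / log2 (n%:R / eps n)| < c^-1.
    by move/cvgr0Pnorm_lt: hlog; apply; rewrite invr_gt0.
  rewrite !near_withinE => hlog'; near=> n => An.
  apply: (@le_trans _ _ (Num.sqrt (8 * delta))); last by rewrite ler_wsqrtr // lerDl sqrtr_ge0.
  apply: hc => //; [by near: n | exact: hk |].
  have [_ [_ xiE] dvN _] := An.
  have xi0 : 0 < log2 (n%:R / eps n).
    rewrite -xiE ltr0n lt0n; apply: contraTneq dvN => ->; rewrite muln0 dvd0n -lt0n.
    by case: An => [[]].
  have /(_ An) : A n -> `|log2 n%:R / log2 (n%:R / eps n)| < c^-1 by near: n.
  move=> /ltr_normlW; rewrite ltr_pdivrMr // mulrC ltr_pdivlMr // mulrC => /ltW.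
  exact.
(* Half of the gap to capacity: once [k n / n] is within [delta] of [rate], it is at most
   [1 - 2p - delta]. *)
pose delta := (1 - 2 * p - rate) / 2; have d0 : 0 < delta by rewrite divr_gt0 // subr_gt0.
apply/cvgr0Pnorm_le => eta eta0; have [c c0 hc] := expected_choi_error_small p01 d0 eta0.
have hk' : \forall n \near within A \oo, `|rate - (k n)%:R / n%:R| < delta.
  by move/cvgrPdist_lt: hk; apply.
have := hlog c; rewrite !near_withinE in hk' * => hlog'; near=> n => An.
rewrite ger0_norm ?expected_choi_error_ge0 //; apply: hc => //; [by near: n | | by move: An; near: n].
have /(_ An) : A n -> `|rate - (k n)%:R / n%:R| < delta by near: n.
by rewrite ltr_norml /delta => /andP[h _]; lra.
Unshelve. all: by end_near.
Qed.
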